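(* Let $\mathfrak g$ be an affine Lie algebra and suppose $\Lambda$ is a dominant integral weight of level $k>0$. Let $N$ be the set of maximal dominant weights in $P(\Lambda)$, $\tilde N=\overset{\circ}{W}\cdot N$, and $\bar N$ a set of representatives of the $T$-classes of $\tilde N$. (1) If $\eta,\zeta\in\Lambda-Q$, then we have $\eta=t_\alpha(\zeta)-s\delta$ for some $\alpha\in M$ and some $s\in\mathbb Z$ if and only if $\tilde\eta=\tilde\zeta$. (2) If $f:\bar N\to\prod_{i=1}^\ell(\mathbb Z/kd_i\mathbb Z)$ denotes the restriction to $\bar N$ of the map $\eta\mapsto\tilde\eta$, then $f$ is injective. (3) If $\mathfrak g$ is of any type other than $A^{(2)}_{2\ell}$, then $f$ is surjective, and thus $\bar N$ has $k^\ell\prod_{i=1}^\ell d_i$ elements. (4) If $\mathfrak g=\mathfrak g(A^{(2)}_{2\ell})$, then the image of $f$ is $(2\mathbb Z/2k\mathbb Z)^{\ell-1}\times\mathbb Z/k\mathbb Z$, and thus $\bar N$ has $k^\ell$ elements.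
   Context: $\mathfrak g$ is the affine Kac--Moody algebra over $\mathbb C$ with $(\ell+1)\times(\ell+1)$ affine Cartan matrix $A=[a_{ij}]_{0\le i,j\le\ell}$, $\mathfrak h$ its Cartan subalgebra (of dimension $\ell+2$), with simple roots $\alpha_0,\dots,\alpha_\ell\in\mathfrak h^*$ and simple coroots $h_0,\dots,h_\ell\in\mathfrak h$, $\langle h_i,\alpha_j\rangle=a_{ij}$. Kac's numbering of nodes is used, i.e. the matrices are as follows ($a_{ii}=2$; each listed pair $\{i,j\}$ gives $a_{ij}=a_{ji}=-1$ except for the stated exceptions; all other off-diagonal entries are $0$; ''chain'' means the pairs $\{i,i+1\}$, $0\le i\le \ell-1$): $A^{(1)}_1$: $a_{01}=a_{10}=-2$. $A^{(1)}_\ell$ ($\ell\ge2$): chain and $\{\ell,0\}$. $B^{(1)}_\ell$ ($\ell\ge3$): $\{0,2\}$, $\{i,i+1\}$ for $1\le i\le\ell-1$, except $a_{\ell,\ell-1}=-2$. $C^{(1)}_\ell$ ($\ell\ge2$): chain, except $a_{1,0}=-2$, $a_{\ell-1,\ell}=-2$. $D^{(1)}_\ell$ ($\ell\ge4$): $\{0,2\}$, $\{i,i+1\}$ for $1\le i\le\ell-2$, $\{\ell-2,\ell\}$. $D^{(2)}_{\ell+1}$ ($\ell\ge2$): chain, except $a_{0,1}=-2$, $a_{\ell,\ell-1}=-2$. $A^{(2)}_{2\ell-1}$ ($\ell\ge3$): $\{0,2\}$, $\{i,i+1\}$ for $1\le i\le\ell-1$, except $a_{\ell-1,\ell}=-2$.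 $A^{(2)}_2$: $a_{01}=-4$, $a_{10}=-1$. $A^{(2)}_{2\ell}$ ($\ell\ge2$): chain, except $a_{0,1}=-2$, $a_{\ell-1,\ell}=-2$. $E^{(1)}_6$: $\{1,2\},\{2,3\},\{3,4\},\{4,5\},\{3,6\},\{6,0\}$. $E^{(1)}_7$: $\{i,i+1\}$ for $0\le i\le5$, and $\{3,7\}$. $E^{(1)}_8$: $\{i,i+1\}$ for $0\le i\le 6$, and $\{5,8\}$. $F^{(1)}_4$: chain ($\ell=4$), except $a_{32}=-2$. $E^{(2)}_6$: chain ($\ell=4$), except $a_{23}=-2$. $G^{(1)}_2$: chain ($\ell=2$), except $a_{21}=-3$. $D^{(3)}_4$: chain ($\ell=2$), except $a_{12}=-3$. Types with superscript $(1)$ are untwisted, the others twisted. The null root is $\delta=\sum_i a_i\alpha_i$, where $(a_0,\dots,a_\ell)$ are the coprime positive integers with $\sum_j a_{ij}a_j=0$ for all $i$; the canonical central element is $c=\sum_i a_i^\vee h_i$, where $(a_0^\vee,\dots,a_\ell^\vee)$ are the coprime positive integers with $\sum_i a_i^\vee a_{ij}=0$ for all $j$. The invariant symmetric bilinear form $(\cdot|\cdot)$ on $\mathfrak h^*$ satisfies $(\alpha_i|\eta)=\frac{a_i^\vee}{a_i}\langle h_i,\eta\rangle$ for all $\eta\in\mathfrak h^*$; in particular $(\alpha_i|\alpha_j)=\frac{a_i^\vee}{a_i}a_{ij}$ and $(\alpha_i|\delta)=(\delta|\delta)=0$. $Q=\sum_i\mathbb Z\alpha_i$. A weight $\eta\in\mathfrak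 h^*$ is dominant integral if $\langle h_i,\eta\rangle\in\mathbb Z_{\ge0}$ for all $i$. The level of $\eta$ is $\langle c,\eta\rangle$. For $\Lambda$ dominant integral, $P(\Lambda)$ is the set of weights of the irreducible integrable highest-weight module $L(\Lambda)$. A weight $\eta\in P(\Lambda)$ is maximal if $\eta+\delta\notin P(\Lambda)$; $\max(\Lambda)$ is the set of maximal weights. $W$ is the group generated by $s_i:\eta\mapsto\eta-\langle h_i,\eta\rangle\alpha_i$, $0\le i\le\ell$, acting on $\mathfrak h^*$; $\overset{\circ}{W}$ is the subgroup generated by $s_1,\dots,s_\ell$. The lattice $M\subset\mathfrak h^*$ has $\mathbb Z$-basis $\frac{d_1\alpha_1}{a_0},\dots,\frac{d_\ell\alpha_\ell}{a_0}$, where $d_i=a_0a_i/a_i^\vee$ if $\mathfrak g$ is untwisted or of type $A^{(2)}_{2\ell}$, and $d_i=1$ for all $i$ in the other twisted types (all $d_i$ are positive integers). $T=\{t_\alpha\mid\alpha\in M\}$ is the abelian normal subgroup of $W$ with $t_\alpha(\eta)=\eta+m\alpha-\left((\eta|\alpha)+\tfrac12(\alpha|\alpha)m\right)\delta$, where $m=\langle c,\eta\rangle$; one has $W=T\rtimes\overset{\circ}{W}$. For $\eta=\Lambda-\sum_{i=0}^\ell b_i\alpha_i\in\Lambda-Q$ with $b_i\in\mathbb Z$, put $\tilde\eta=\big((a_0b_1-a_1b_0)\bmod kd_1,\dots,(a_0b_\ell-a_\ell b_0)\bmod kd_\ell\big)\in\prod_{i=1}^\ell(\mathbb Z/kd_i\mathbb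 Z)$. $N$ is the set of dominant elements of $\max(\Lambda)$; $\tilde N=\overset{\circ}{W}\cdot N$ is the union of the $\overset{\circ}{W}$-orbits of its elements. Two elements of $\tilde N$ are in the same $T$-class if an element of $T$ maps one to the other; $\bar N\subseteq\tilde N$ contains exactly one element of each $T$-class. For $A^{(2)}_{2\ell}$ one has $d_i=2$ for $1\le i\le\ell-1$ and $d_\ell=1$, so the target of $f$ is $(\mathbb Z/2k\mathbb Z)^{\ell-1}\times\mathbb Z/k\mathbb Z$, and $2\mathbb Z/2k\mathbb Z$ denotes the subgroup of even classes in $\mathbb Z/2k\mathbb Z$. *)

(* Defs.v *)
From HB Require Import structures.
From mathcomp Require Import all_boot all_order all_algebra.
From mathcomp Require Import complex.
From mathcomp Require Import boolp classical_sets functions cardinality reals.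

Set Implicit Arguments.
Unset Strict Implicit.
Unset Printing Implicit Defensive.

Import Order.TTheory GRing.Theory Num.Theory.

Local Open Scope classical_set_scope.
Local Open Scope ring_scope.

(* A_1 l = A^(1)_l, ..., D_2 l = D^(2)_(l+1), A_2_odd l = A^(2)_(2l-1),
   A_2_even l = A^(2)_(2l); the argument l is always the rank, i.e. the Cartan
   matrix has nodes 0, ..., l. *)
Inductive affine_type :=
| A_1 of nat | B_1 of nat | C_1 of nat | D_1 of nat
| D_2 of nat | A_2_odd of nat | A_2_even of nat
| E6_1 | E7_1 | E8_1 | F4_1 | E6_2 | G2_1 | D4_3.

Definition admissible (X : affine_type) : bool :=
  match X with
  | A_1 l => 1 <= l
  | B_1 l => 3 <= l
  | C_1 l => 2 <= l
  | D_1 l => 4 <= l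
  | D_2 l => 2 <= l
  | A_2_odd l => 3 <= l
  | A_2_even l => 1 <= l
  | _ => true
  end%N.

Definition rk (X : affine_type) : nat :=
  match X with
  | A_1 l | B_1 l | C_1 l | D_1 l | D_2 l | A_2_odd l | A_2_even l => l
  | E6_1 => 6
  | E7_1 => 7
  | E8_1 => 8
  | F4_1 | E6_2 => 4
  | G2_1 | D4_3 => 2
  end%N.

Definition untwisted (X : affine_type) : bool :=
  match X with
  | A_1 _ | B_1 _ | C_1 _ | D_1 _ | E6_1 | E7_1 | E8_1 | F4_1 | G2_1 => true
  | _ => false
  end.

Definition is_A_2_even (X : affine_type) : bool :=
  if X is A_2_even _ then true else false.

(* the pairs {i, i+1} for m <= i < n *)
Definition chain (m n : nat) : seq (nat * nat) :=
  [seq (i, i.+1) | i <- iota m (n - m)].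

Definition bonds (X : affine_type) : seq (nat * nat) :=
  match X with
  | A_1 l => (l, 0) :: chain 0 l
  | B_1 l => (0, 2) :: chain 1 l
  | C_1 l => chain 0 l
  | D_1 l => [:: (0, 2), (l - 2, l) & chain 1 (l - 1)]
  | D_2 l => chain 0 l
  | A_2_odd l => (0, 2) :: chain 1 l
  | A_2_even l => chain 0 l
  | E6_1 => [:: (1, 2); (2, 3); (3, 4); (4, 5); (3, 6); (6, 0)]
  | E7_1 => (3, 7) :: chain 0 6
  | E8_1 => (5, 8) :: chain 0 7
  | F4_1 | E6_2 => chain 0 4
  | G2_1 | D4_3 => chain 0 2
  end%N.

(* ((i, j), z) stands for a_ij = z *)
Definition exceptional (X : affine_type) : seq ((nat * nat) * int) :=
  match X with
  | A_1 1 => [:: ((0%N, 1%N), -2); ((1%N, 0%N), -2)]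
  | B_1 l => [:: ((l, l.-1), -2)]
  | C_1 l => [:: ((1%N, 0%N), -2); ((l.-1, l), -2)]
  | D_2 l => [:: ((0%N, 1%N), -2); ((l, l.-1), -2)]
  | A_2_odd l => [:: ((l.-1, l), -2)]
  | A_2_even 1 => [:: ((0%N, 1%N), -4)]
  | A_2_even l => [:: ((0%N, 1%N), -2); ((l.-1, l), -2)]
  | F4_1 => [:: ((3%N, 2%N), -2)]
  | E6_2 => [:: ((2%N, 3%N), -2)]
  | G2_1 => [:: ((2%N, 1%N), -3)]
  | D4_3 => [:: ((1%N, 2%N), -3)]
  | _ => [::]
  end.

Definition cartan_entry (X : affine_type) (i j : nat) : int :=
  if i == j then 2
  else if [seq x.2 | x <- exceptional X & x.1 == (i, j)] is z :: _ then z
  else if ((i, j) \in bonds X) || ((j, i) \in bonds X) then -1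
  else 0.

Definition cartan (X : affine_type) : 'M[int]_((rk X).+1) :=
  \matrix_(i, j) cartan_entry X i j.

(* The a_i satisfy is_marks (cartan X), the a_i^vee satisfy
   is_marks (cartan X)^T. *)
Definition is_marks n (A : 'M[int]_n) (a : 'I_n -> nat) : Prop :=
  [/\ forall i, (0 < a i)%N,
      \big[gcdn/0%N]_i a i = 1%N
    & forall i, \sum_j A i j * (a j)%:Z = 0].

Section LieAlgebras.
Variable K : fieldType.

Record lieAlgebra := LieAlgebra {
  lie_sort :> lmodType K;
  bracket : lie_sort -> lie_sort -> lie_sort;
  bracket_linearl : forall y, linear (bracket^~ y);
  bracket_linearr : forall x, linear (bracket x);
  bracket_alt : forall x, bracket x x = 0;
  bracket_jacobi : forall x y z,
    bracket x (bracket y z) + bracket y (bracket z x)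
      + bracket z (bracket x y) = 0
}.

Definition subspace (V : lmodType K) (U : set V) : Prop :=
  U 0 /\ forall (c : K) u v, U u -> U v -> U (c *: u + v).

Definition subalgebra (g : lieAlgebra) (S : set g) : Prop :=
  subspace S /\ forall x y, S x -> S y -> S (bracket x y).

Definition ideal (g : lieAlgebra) (I : set g) : Prop :=
  subspace I /\ forall x y, I y -> I (bracket x y).

Record representation (g : lieAlgebra) := Representation {
  rep_sort :> lmodType K;
  act : g -> rep_sort -> rep_sort;
  act_linearl : forall v, linear (act^~ v);
  act_linearr : forall x, linear (act x);
  act_bracket : forall x y v,
    act (bracket x y) v = act x (act y v) - act y (act x v)
}.

Definition submodule (g : lieAlgebra) (V : representation g) (U : set V) :=
  subspace U /\ forall x u, U u -> U (act x u).

Definition irreducible (g : lieAlgebra) (V : representation g) : Prop :=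
  (exists v : V, v != 0) /\
  forall U : set V, submodule U -> U = [set 0] \/ U = setT.

End LieAlgebras.

(* The Kac-Moody algebra g(A), A = cartan X, over the complex numbers R[i]:
   a realization (km_h, km_root, km_coroot) of A together with the quotient of
   the Lie algebra given by the Chevalley relations by its largest ideal meeting
   the Cartan subalgebra trivially.  This is expressed by the relations, by
   generation, and by the absence of nonzero ideals meeting the Cartan
   subalgebra trivially, which determine g(A) up to isomorphism (Kac, Infinite
   dimensional Lie algebras, Proposition 1.4). *)
Record affineKM (R : realType) (X : affine_type) := AffineKM {
  km_g :> lieAlgebra R[i];
  km_h : vectType R[i];
  km_emb : {linear km_h -> km_g};
  km_coroot : 'I_(rk X).+1 -> km_h;
  km_root : 'I_(rk X).+1 -> 'Hom(km_h, R[i]^o);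
  km_e : 'I_(rk X).+1 -> km_g;
  km_f : 'I_(rk X).+1 -> km_g;
  km_dim : \dim {:km_h} = (rk X).+2;
  km_coroot_free : free [seq km_coroot i | i <- enum 'I_(rk X).+1];
  km_root_free : free [seq km_root i | i <- enum 'I_(rk X).+1];
  km_pairing : forall i j, km_root j (km_coroot i) = (cartan X i j)%:~R;
  km_emb_inj : injective km_emb;
  km_hh : forall x y, bracket (km_emb x) (km_emb y) = 0;
  km_he : forall x i, bracket (km_emb x) (km_e i) = km_root i x *: km_e i;
  km_hf : forall x i, bracket (km_emb x) (km_f i) = - (km_root i x *: km_f i);
  km_ef : forall i j,
    bracket (km_e i) (km_f j) = if i == j then km_emb (km_coroot i) else 0;
  km_gen : forall S : set km_g, subalgebra S ->
    (forall x, S (km_emb x)) -> (forall i, S (km_e i)) ->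
    (forall i, S (km_f i)) -> S = setT;
  km_ideal : forall I : set km_g, ideal I ->
    (forall x, I (km_emb x) -> x = 0) -> I = [set 0]
}.

(* the dual of the Cartan subalgebra *)
Notation weight G := 'Hom(km_h G, _^o).

Section Weights.
Variables (R : realType) (X : affine_type) (G : affineKM R X).

Notation C := R[i].
Notation l := (rk X).
Notation wt := (weight G).

(* the node i + 1, so that the nodes 1, ..., l are indexed by 'I_l *)
Definition node (i : 'I_l) : 'I_l.+1 := lift ord0 i.

(* a and av stand for the a_i and the a_i^vee *)
Variables a av : 'I_l.+1 -> nat.

Definition null_root : wt := \sum_i (a i)%:R *: km_root G i.

Definition central_element : km_h G := \sum_i (av i)%:R *: km_coroot G i.

Definition level (eta : wt) : C := eta central_element.

Definition dominant_integral (eta : wt) : Prop :=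
  forall i, exists n : nat, eta (km_coroot G i) = n%:R.

(* These conditions determine form al eta for al in the span of the simple
   roots, and they imply that form is nondegenerate and W-invariant. *)
Definition invariant_form (form : wt -> wt -> C) : Prop :=
  [/\ forall x, linear (form x : wt -> C^o),
      forall x y, form x y = form y x
    & forall i eta, form (km_root G i) eta =
        (av i)%:R / (a i)%:R * eta (km_coroot G i)].

Definition weight_space (V : representation G) (mu : wt) : set V :=
  [set v | forall x, act (km_emb G x) v = (mu x : C) *: v].

Definition weights (V : representation G) : set wt :=
  [set mu | exists2 v : V, weight_space mu v & v != 0].

Definition integrable (V : representation G) : Prop :=
  [/\ forall v : V, exists2 s : seq V, v = \sum_(u <- s) u &
        forall u, u \in s -> exists mu, weight_space mu u,
      forall i (v : V), exists n, iter n (act (km_e G i)) v = 0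
    & forall i (v : V), exists n, iter n (act (km_f G i)) v = 0].

(* V is (isomorphic to) L(Lam); a nonzero vector generates V by
   irreducibility. *)
Definition irreducible_integrable_highest_weight
    (Lam : wt) (V : representation G) : Prop :=
  [/\ irreducible V, integrable V &
      exists v : V, [/\ v != 0, weight_space Lam v
                      & forall i, act (km_e G i) v = 0]].

Definition maximal_weights (V : representation G) : set wt :=
  [set eta | weights V eta /\ ~ weights V (eta + null_root)].

Definition max_dominant (V : representation G) : set wt :=
  [set eta | maximal_weights V eta /\ dominant_integral eta].

Definition reflection (i : 'I_l.+1) (eta : wt) : wt :=
  eta - (eta (km_coroot G i) : C) *: km_root G i.

(* The simple reflections being involutions, the elements of the finite Weyl
   group are the words in s_1, ..., s_l. *)
Definition finite_weyl_orbit (S : set wt) : set wt :=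
  [set eta | exists w : seq 'I_l, exists2 mu, S mu &
     eta = foldr (fun i => reflection (node i)) mu w].

(* The division is exact. *)
Definition d (i : 'I_l) : nat :=
  if untwisted X || is_A_2_even X
  then ((a ord0 * a (node i)) %/ av (node i))%N else 1%N.

Definition latticeM : set wt :=
  [set al | exists z : 'I_l -> int,
     al = \sum_i (z i)%:~R *: (((d i)%:R / (a ord0)%:R) *: km_root G (node i))].

Definition transl (form : wt -> wt -> C) (al eta : wt) : wt :=
  let m := level eta in
  eta + m *: al - (form eta al + 2^-1 * form al al * m) *: null_root.

Definition same_T_class (form : wt -> wt -> C) (eta zeta : wt) : Prop :=
  exists2 al, latticeM al & zeta = transl form al eta.

Definition is_T_transversal (form : wt -> wt -> C) (S Sbar : set wt) : Prop :=
  Sbar `<=` S /\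
  forall eta, S eta -> exists! zeta, Sbar zeta /\ same_T_class form eta zeta.

Definition lower (Lam : wt) (b : {ffun 'I_l.+1 -> int}) : wt :=
  Lam - \sum_i (b i)%:~R *: km_root G i.

(* Lam - Q *)
Definition root_coset (Lam : wt) : set wt := range (lower Lam).

(* The b_i are unique, the simple roots being linearly independent. *)
Definition root_coord (Lam eta : wt) : {ffun 'I_l.+1 -> int} :=
  xget [ffun=> 0] [set b | eta = lower Lam b].

(* Z/nZ for n > 0, including n = 1 (unlike 'Z_n) *)
Definition Zmod (n : nat) : finType := 'I_n.-1.+1.

Definition residue (n : nat) (z : int) : Zmod n := inZp `|(z %% n)%Z|%N.

Definition even_class (n : nat) : set (Zmod n) :=
  range (fun z : int => residue n (2 * z)).

Definition residues (k : nat) : finType :=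
  {dffun forall i : 'I_l, Zmod (k * d i)}.

Definition tilde (k : nat) (Lam eta : wt) : residues k :=
  let b := root_coord Lam eta in
  [ffun i => residue (k * d i)
     ((a ord0)%:Z * b (node i) - (a (node i))%:Z * b ord0)].

End Weights.

(* Main.v *)
(* Let beta_i = d_i alpha_i / a_0 for i > 0 be the basis of M and let
   beta_0 = alpha_0 - delta / a_0, so that theta / a_0 = - beta_0 lies in M.

   Translations. The vector theta / a_0 has minimal norm 2 / a_0 in M. Moving
   it down by simple reflections, no coefficient can become negative unless the
   vector is some beta_i, since otherwise its positive and negative parts would
   both be nonzero lattice vectors and the norm would be too large. Hence the
   reflection in theta lies in the finite Weyl group, t_{theta / a_0} =
   s_0 s_theta lies in W, and W is the product of the finite Weyl group and T as
   soon as the finite Weyl group orbit of theta / a_0 spans M. The latter holds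
   because one passes from beta_0 to the other beta_j along edges of the diagram
   with s_j beta_i = beta_i + beta_j, the end of the diagram being reached, if
   necessary, through the linear relation between the beta_i.

   Weights. Highest weight theory puts P(Lambda) below Lambda, and sl_2-theory
   makes P(Lambda) stable under W and under eta |-> eta - alpha_i whenever
   <h_i, eta> > 0. These two properties suffice. A dominant element of
   Lambda - Q below a weight is a weight: if kappa is the difference, then
   (mu | kappa) > 0 because the form is positive semidefinite on Q with kernel
   spanned by delta, and the level is positive. Hence P(Lambda) is stable under
   subtracting delta, so a maximal weight is determined modulo delta. Moreover,
   a suitable translation makes <h_j, eta> positive or negative, so
   P(Lambda) + C delta is stable under adding and subtracting simple roots, that
   is, contains Lambda - Q. *)

Require Import Defs.
From HB Require Import structures.
From mathcomp Require Import all_boot all_order all_algebra.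
From mathcomp Require Import complex.
From mathcomp Require Import boolp classical_sets functions cardinality reals.
From mathcomp Require Import zify ring.

Set Implicit Arguments.
Unset Strict Implicit.
Unset Printing Implicit Defensive.

Import Order.TTheory GRing.Theory Num.Theory.

Local Open Scope classical_set_scope.
Local Open Scope card_scope.
Local Open Scope ring_scope.

(** * Marks of the affine Cartan matrices *)

Definition mark (X : affine_type) (i : nat) : nat :=
  match X with
  | A_1 _ | D_2 _ => 1
  | B_1 _ => if i <= 1 then 1 else 2
  | C_1 l => if (i == 0) || (i == l) then 1 else 2
  | D_1 l => if (i <= 1) || (l.-1 <= i) then 1 else 2
  | A_2_odd l => if (i <= 1) || (i == l) then 1 else 2
  | A_2_even l => if i == l then 1 else 2
  | E6_1 => nth 1 [:: 1; 1; 2; 3; 2; 1; 2] i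
  | E7_1 => nth 1 [:: 1; 2; 3; 4; 3; 2; 1; 2] i
  | E8_1 => nth 1 [:: 1; 2; 3; 4; 5; 6; 4; 2; 3] i
  | F4_1 => nth 1 [:: 1; 2; 3; 4; 2] i
  | E6_2 => nth 1 [:: 1; 2; 3; 2; 1] i
  | G2_1 => nth 1 [:: 1; 2; 3] i
  | D4_3 => nth 1 [:: 1; 2; 1] i
  end%N.

Definition comark (X : affine_type) (i : nat) : nat :=
  match X with
  | A_1 _ | C_1 _ => 1
  | B_1 l => if (i <= 1) || (i == l) then 1 else 2
  | D_2 l => if (i == 0) || (i == l) then 1 else 2
  | A_2_odd l => if i <= 1 then 1 else 2
  | A_2_even l => if i == 0 then 1 else 2
  | F4_1 => nth 1 [:: 1; 2; 3; 2; 1] i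
  | E6_2 => nth 1 [:: 1; 2; 3; 4; 2] i
  | G2_1 => nth 1 [:: 1; 2; 1] i
  | D4_3 => nth 1 [:: 1; 2; 3] i
  | _ => mark X i
  end%N.

(** * Entries of the Cartan matrices in closed form *)

Lemma mem_chain m n i j : ((i, j) \in chain m n) = (j == i.+1) && (m <= i < n)%N.
Proof.
apply/mapP/andP => [[x]|[/eqP-> lin]].
  by rewrite mem_iota => lx [-> ->]; split=> //; lia.
by exists i => //; rewrite mem_iota; lia.
Qed.

(** For the infinite families this reduces a row sum of arbitrary length to a node and its few
    neighbours. *)
Lemma sum_support (F : nat -> int) n (s : seq nat) :
  uniq s -> all (fun j => j < n)%N s -> (forall j, (j < n)%N -> j \notin s -> F j
    = 0) ->
  \sum_(j < n) F j = \sum_(j <- s) F j.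
Proof.
move=> us sn F0; rewrite -(big_mkord xpredT) /index_iota subn0.
rewrite (bigID (mem s)) /= [X in _ + X]big1_seq ?addr0; last first.
  by move=> j /andP[js]; rewrite mem_iota => jn; apply: F0 => //; lia.
rewrite -big_filter; apply: perm_big; apply: uniq_perm => //.
  by rewrite filter_uniq ?iota_uniq.
move=> j; rewrite mem_filter mem_iota /= add0n.
by case js: (j \in s) => //=; apply: (allP sn).
Qed.

Definition entryE := (in_cons, mem_chain, xpair_eqE).

(** The closed forms turn membership in the list of bonds into inequalities between indices, which
    [lia] decides. Rank 1, where the matrix looks different, is left to direct computation. *)
Lemma entry_A l i j : (2 <= l)%N -> (i <= l)%N -> (j <= l)%N ->
  cartan_entry (A_1 l) i j =
  if i == j then 2 else
  if [|| j == i.+1, i == j.+1, (i == 0%N) && (j == l) | (i == l) && (j == 0%N)]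
  then -1 else 0.
Proof.
move=> l2 li lj; rewrite /cartan_entry.
have -> : exceptional (A_1 l) = [::] by case: l l2 {li lj} => [|[|l]].
rewrite /bonds !entryE /=.
by repeat case: ifP => ? //; lia.
Qed.

Lemma entry_B l i j : (3 <= l)%N -> (i <= l)%N -> (j <= l)%N ->
  cartan_entry (B_1 l) i j =
  if i == j then 2 else if (i == l) && (j == l.-1) then -2 else
  if [|| (j == i.+1) && (0 < i)%N, (i == j.+1) && (0 < j)%N,
         (i == 0%N) && (j == 2%N) | (i == 2%N) && (j == 0%N)]
  then -1 else 0.
Proof.
move=> l3 li lj; rewrite /cartan_entry /bonds !entryE /=.
by case: ifP => ? //; rewrite !xpair_eqE; repeat (case: ifP => ? //=); lia.
Qed.

Lemma entry_C l i j : (2 <= l)%N -> (i <= l)%N -> (j <= l)%N ->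
  cartan_entry (C_1 l) i j =
  if i == j then 2 else
  if (i == 1%N) && (j == 0%N) || (i == l.-1) && (j == l) then -2 else
  if (j == i.+1) || (i == j.+1) then -1 else 0.
Proof.
move=> l3 li lj; rewrite /cartan_entry /bonds !entryE /=.
by case: ifP => ? //; rewrite !xpair_eqE; repeat (case: ifP => ? //=); lia.
Qed.

Lemma entry_D l i j : (4 <= l)%N -> (i <= l)%N -> (j <= l)%N ->
  cartan_entry (D_1 l) i j =
  if i == j then 2 else
  if [|| (j == i.+1) && (0 < i < l.-1)%N, (i == j.+1) && (0 < j < l.-1)%N,
      (i == 0%N) && (j == 2%N), (i == 2%N) && (j == 0%N),
      (i == l.-2) && (j == l) | (i == l) && (j == l.-2)]
  then -1 else 0.
Proof.
move=> l3 li lj; rewrite /cartan_entry /bonds !entryE /=.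
by repeat case: ifP => ? //; lia.
Qed.

Lemma entry_D2 l i j : (2 <= l)%N -> (i <= l)%N -> (j <= l)%N ->
  cartan_entry (D_2 l) i j =
  if i == j then 2 else
  if (i == 0%N) && (j == 1%N) || (i == l) && (j == l.-1) then -2 else
  if (j == i.+1) || (i == j.+1) then -1 else 0.
Proof.
move=> l3 li lj; rewrite /cartan_entry /bonds !entryE /=.
by case: ifP => ? //; rewrite !xpair_eqE; repeat (case: ifP => ? //=); lia.
Qed.

Lemma entry_A2_odd l i j : (3 <= l)%N -> (i <= l)%N -> (j <= l)%N ->
  cartan_entry (A_2_odd l) i j =
  if i == j then 2 else if (i == l.-1) && (j == l) then -2 else
  if [|| (j == i.+1) && (0 < i)%N, (i == j.+1) && (0 < j)%N,
         (i == 0%N) && (j == 2%N) | (i == 2%N) && (j == 0%N)]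
  then -1 else 0.
Proof.
move=> l3 li lj; rewrite /cartan_entry /bonds !entryE /=.
by case: ifP => ? //; rewrite !xpair_eqE; repeat (case: ifP => ? //=); lia.
Qed.

Lemma entry_A2_even l i j : (2 <= l)%N -> (i <= l)%N -> (j <= l)%N ->
  cartan_entry (A_2_even l) i j =
  if i == j then 2 else
  if (i == 0%N) && (j == 1%N) || (i == l.-1) && (j == l) then -2 else
  if (j == i.+1) || (i == j.+1) then -1 else 0.
Proof.
move=> l2 li lj; rewrite /cartan_entry.
have -> : exceptional (A_2_even l) = [:: ((0%N, 1%N), -2); ((l.-1, l), -2)].
  by case: l l2 {li lj} => [|[|l]].
rewrite /bonds !entryE /=.
by case: ifP => ? //; rewrite !xpair_eqE; repeat (case: ifP => ? //=); lia.
Qed.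

(** * The marks and comarks annihilate the Cartan matrix *)

Ltac kill_ifs := repeat (case: ifP => [?|_]; [exfalso; lia|]); lia.
Ltac prune := try (exfalso; lia).
Ltac solve_ifs := repeat (case: ifP => ? //=; prune); lia.

Definition row_term X i j : int := cartan_entry X i j * (mark X j)%:Z.
Definition col_term X i j : int := cartan_entry X j i * (comark X j)%:Z.

Ltac local_sum entry s :=
  rewrite (@sum_support _ _ s);
  [ rewrite !big_cons big_nil /row_term /col_term /= !entry; solve_ifs
  | rewrite /= ?inE; lia
  | rewrite /=; lia
  | let j := fresh "j" in let js := fresh "js" in let jl := fresh "jl" in
    move=> j jl; rewrite !inE => js; rewrite /row_term /col_term;
    rewrite (_ : cartan_entry _ _ _ = 0) ?mul0r //;
    rewrite entry; kill_ifs ].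

(** In this form the sums of the exceptional types and of rank 1 evaluate by computation. *)
Lemma sum_foldr n (F : nat -> int) :
  \sum_(j < n) F j = foldr (fun j s => F j + s) 0 (iota 0 n).
Proof.
rewrite -(big_mkord xpredT) /index_iota subn0; elim: (iota 0 n) => [|j s IH].
  by rewrite big_nil.
by rewrite big_cons IH.
Qed.

Ltac split_chain entry i l :=
  have [->|?] := eqVneq i 0%N; [local_sum entry [:: 0; 1]%N|];
  have [->|?] := eqVneq i l; [local_sum entry [:: l.-1; l]%N|];
  local_sum entry [:: i.-1; i; i.+1]%N.

Ltac split_fork entry i l :=
  have [->|?] := eqVneq i 0%N; [local_sum entry [:: 0; 2]%N|];
  have [->|?] := eqVneq i 1%N; [local_sum entry [:: 1; 2]%N|];
  have [->|?] := eqVneq i 2%N; [local_sum entry [:: 0; 1; 2; 3]%N|];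
  have [->|?] := eqVneq i l; [local_sum entry [:: l.-1; l]%N|];
  local_sum entry [:: i.-1; i; i.+1]%N.

Ltac split_cycle entry i l :=
  have [->|?] := eqVneq i 0%N; [local_sum entry [:: 0; 1; l]%N|];
  have [->|?] := eqVneq i l; [local_sum entry [:: 0; l.-1; l]%N|];
  local_sum entry [:: i.-1; i; i.+1]%N.

(** The two forks meet when l = 4: then the nodes 2 and l - 2 coincide, and this node has four
    neighbours. *)
Ltac split_double_fork entry i l :=
  have [->|?] := eqVneq i 0%N; [local_sum entry [:: 0; 2]%N|];
  have [->|?] := eqVneq i 1%N; [local_sum entry [:: 1; 2]%N|];
  have [->|?] := eqVneq i l; [local_sum entry [:: l.-2; l]%N|];
  have [->|?] := eqVneq i l.-1; [local_sum entry [:: l.-2; l.-1]%N|];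
  have [->|?] := eqVneq i 2%N;
    [have [?|?] := eqVneq l 4%N;
       [local_sum entry [:: 0; 1; 2; 3; 4]%N|local_sum entry [:: 0; 1; 2; 3]%N]|];
  have [->|?] := eqVneq i l.-2; [local_sum entry [:: l.-2.-1; l.-2; l.-1; l]%N|];
  local_sum entry [:: i.-1; i; i.+1]%N.

Lemma row_sum X i : admissible X -> (i <= rk X)%N ->
  \sum_(j < (rk X).+1) row_term X i j = 0.
Proof.
case: X => [l|l|l|l|l|l|l|||||||] /= hl il.
- have [l1|l1] := eqVneq l 1%N.
    by move: il; rewrite l1 sum_foldr; case: i => [|[|i]].
  by split_cycle entry_A i l.
- by split_fork entry_B i l.
- by split_chain entry_C i l.
- by split_double_fork entry_D i l.
- by split_chain entry_D2 i l.
- by split_fork entry_A2_odd i l.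
- have [l1|l1] := eqVneq l 1%N.
    by move: il; rewrite l1 sum_foldr; case: i => [|[|i]].
  by split_chain entry_A2_even i l.
- by rewrite sum_foldr; do 7![case: i il => [|i il]; first by []].
- by rewrite sum_foldr; do 8![case: i il => [|i il]; first by []].
- by rewrite sum_foldr; do 9![case: i il => [|i il]; first by []].
- by rewrite sum_foldr; do 5![case: i il => [|i il]; first by []].
- by rewrite sum_foldr; do 5![case: i il => [|i il]; first by []].
- by rewrite sum_foldr; do 3![case: i il => [|i il]; first by []].
- by rewrite sum_foldr; do 3![case: i il => [|i il]; first by []].
Qed.

Lemma col_sum X i : admissible X -> (i <= rk X)%N ->
  \sum_(j < (rk X).+1) col_term X i j = 0.
Proof.
case: X => [l|l|l|l|l|l|l|||||||] /= hl il.
- have [l1|l1] := eqVneq l 1%N.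
    by move: il; rewrite l1 sum_foldr; case: i => [|[|i]].
  by split_cycle entry_A i l.
- by split_fork entry_B i l.
- by split_chain entry_C i l.
- by split_double_fork entry_D i l.
- by split_chain entry_D2 i l.
- by split_fork entry_A2_odd i l.
- have [l1|l1] := eqVneq l 1%N.
    by move: il; rewrite l1 sum_foldr; case: i => [|[|i]].
  by split_chain entry_A2_even i l.
- by rewrite sum_foldr; do 7![case: i il => [|i il]; first by []].
- by rewrite sum_foldr; do 8![case: i il => [|i il]; first by []].
- by rewrite sum_foldr; do 9![case: i il => [|i il]; first by []].
- by rewrite sum_foldr; do 5![case: i il => [|i il]; first by []].
- by rewrite sum_foldr; do 5![case: i il => [|i il]; first by []].
- by rewrite sum_foldr; do 3![case: i il => [|i il]; first by []].
- by rewrite sum_foldr; do 3![case: i il => [|i il]; first by []].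
Qed.

(* At the node 0 this is a_0, so that beta_0 = alpha_0 - delta / a_0 obeys the
   same formulas as beta_i = d_i alpha_i / a_0, i > 0. *)
Definition dX (X : affine_type) (i : nat) : nat :=
  if i == 0%N then mark X 0 else
  if untwisted X || is_A_2_even X then ((mark X 0 * mark X i) %/ comark X i)%N
  else 1%N.

Lemma mark_gt0 X i : (i <= rk X)%N -> (0 < mark X i)%N.
Proof.
case: X => [l|l|l|l|l|l|l|||||||] //=; try by case: ifP.
all: by do 9?[case: i => [|i] //=].
Qed.

Lemma comark_gt0 X i : (i <= rk X)%N -> (0 < comark X i)%N.
Proof.
case: X => [l|l|l|l|l|l|l|||||||] //=; try by case: ifP.
all: by do 9?[case: i => [|i] //=].
Qed.

Lemma comark0 X : comark X 0 = 1%N.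
Proof. by case: X. Qed.

(** This makes the coefficients a_i / d_i of the linear relation between the beta_i integers. *)
Lemma dX_dvd X i : admissible X -> (i <= rk X)%N ->
  (0 < dX X i)%N && (dX X i %| mark X i)%N.
Proof.
case: X => [l|l|l|l|l|l|l|||||||] /= hl; rewrite /dX /=.
1-7: move=> il; case: eqVneq => [?|i0] /=; repeat case: ifP => ? //; try lia.
all: by do 9?[case: i => [|i] //=].
Qed.

Lemma dX_comark X i : admissible X -> (0 < i <= rk X)%N ->
  untwisted X || is_A_2_even X ->
  (dX X i * comark X i = mark X 0 * mark X i)%N.
Proof.
case: X => [l|l|l|l|l|l|l|||||||] //= hl; rewrite /dX /=.
1-5: case: eqVneq => [?|i0] /=; repeat case: ifP => ? //; try lia.
all: by do 9?[case: i => [|i] //=].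
Qed.

(** In these types d_i = a_0 = 1, so the factor a_i^vee / a_i relating (beta_i | eta) to <h_i, eta>,
    i > 0, is an integer. *)
Lemma mark_dvd_comark X i : (i <= rk X)%N ->
  ~~ (untwisted X || is_A_2_even X) -> (mark X i %| comark X i)%N.
Proof.
case: X => [l|l|l|l|l|l|l|||||||] //=.
1-2: repeat case: ifP => ? //; try lia.
all: by do 9?[case: i => [|i] //=].
Qed.

Lemma mark0 X : admissible X -> mark X 0 = if is_A_2_even X then 2%N else 1%N.
Proof. by case: X => [l|l|l|l|l|l|l|||||||] //=; case: l. Qed.

Lemma mark_A_2_even X i : is_A_2_even X -> mark X i = if i == rk X then 1%N else 2%N.
Proof. by case: X. Qed.

Lemma dX_A_2_even X i : admissible X -> is_A_2_even X -> (0 < i)%N ->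
  dX X i = if i == rk X then 1%N else 2%N.
Proof.
by case: X => //= l l0 _; rewrite /dX /=; case: i => // i _;
  case: l l0 => //= l _; case: ifP.
Qed.

(** * Propagation of a property along the diagram *)

Section Generation.
Variables (X : affine_type) (S : nat -> Prop).
Hypothesis adm : admissible X.
Hypothesis S0 : S 0.
(* The condition on i, j says that s_j beta_i = beta_i + beta_j. *)
Hypothesis S_edge : forall i j, (i <= rk X)%N -> (0 < j <= rk X)%N ->
  (dX X i)%:Z * cartan_entry X j i = - (dX X j)%:Z -> S i -> S j.
(* This is the linear relation between the beta_i, in which beta_j has the
   coefficient a_j / d_j = 1. *)
Hypothesis S_last : forall j, (0 < j <= rk X)%N -> mark X j = dX X j ->
  (forall i, (i <= rk X)%N -> i != j -> S i) -> S j.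

Lemma generation_path m n : (m <= n <= rk X)%N -> S m ->
  (forall i, (m <= i < n)%N ->
     (dX X i)%:Z * cartan_entry X i.+1 i = - (dX X i.+1)%:Z) ->
  forall i, (m <= i <= n)%N -> S i.
Proof.
move=> mn Sm E i; elim: i => [|i IH] im; first by move: Sm; have -> : m = 0%N by lia.
have [->//|mi] := eqVneq i.+1 m.
by apply: (S_edge _ _ (E i _)); try apply: IH; lia.
Qed.

Ltac solve_edge entry := rewrite entry /dX; [|lia|lia|lia]; rewrite /=; solve_ifs.

Lemma generation : forall i, (i <= rk X)%N -> S i.
Proof.
case: X adm S_edge S_last generation_path => [l|l|l|l|l|l|l|||||||] /= hl edge
  last path.
- have [l1|l1] := eqVneq l 1%N.
    subst l; case=> [|[|i]] // _; apply: last => //.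
    by case=> [|[|i]].
  move=> i il; apply: (path 0%N l); [lia|done|move=> k kl; solve_edge entry_A|lia].
- have S2 : S 2%N by apply: (edge 0%N) => //; [lia|solve_edge entry_B].
  have S1 : S 1%N by apply: (edge 2%N) => //; [lia|lia|solve_edge entry_B].
  case=> [|[|i]] // il; apply: (path 2%N l); [lia|done|move=> k kl;
    solve_edge entry_B|lia].
(* The last edge only gives s_l beta_{l-1} = beta_{l-1} + 2 beta_l, so the node l is reached through
   the linear relation. The same happens for [D_2] and [A_2_even]. *)
- have Sl i : (i < l)%N -> S i.
    move=> il; apply: (path 0%N l.-1); [lia|done|move=> k kl; solve_edge entry_C|lia].
  move=> i il; have [->|] := eqVneq i l; last by move=> ?; apply: Sl; lia.
  apply: last; [lia|rewrite /dX; solve_ifs|move=> j jl jn; apply: Sl; lia].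
- have S2 : S 2%N by apply: (edge 0%N) => //; [lia|solve_edge entry_D].
  have S1 : S 1%N by apply: (edge 2%N) => //; [lia|lia|solve_edge entry_D].
  have Sl i : (2 <= i < l)%N -> S i.
    move=> il; apply: (path 2%N l.-1); [lia|done|move=> k kl; solve_edge entry_D|lia].
  have Sn : S l.
    apply: (edge l.-2) => //; [lia|lia|solve_edge entry_D|apply: Sl; lia].
  case=> [|[|i]] // il; have [->//|] := eqVneq i.+2 l => ?; apply: Sl; lia.
- have Sl i : (i < l)%N -> S i.
    move=> il; apply: (path 0%N l.-1); [lia|done|move=> k kl; solve_edge entry_D2|lia].
  move=> i il; have [->|] := eqVneq i l; last by move=> ?; apply: Sl; lia.
  apply: last; [lia|rewrite /dX; solve_ifs|move=> j jl jn; apply: Sl; lia].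
- have S2 : S 2%N by apply: (edge 0%N) => //; [lia|solve_edge entry_A2_odd].
  have S1 : S 1%N by apply: (edge 2%N) => //; [lia|lia|solve_edge entry_A2_odd].
  case=> [|[|i]] // il; apply: (path 2%N l); [lia|done|move=> k kl;
    solve_edge entry_A2_odd|lia].
- have [l1|l1] := eqVneq l 1%N.
    subst l; case=> [|[|i]] // _; apply: last => //.
    by case=> [|[|i]].
  have Sl i : (i < l)%N -> S i.
    move=> il; apply: (path 0%N l.-1); [lia|done|move=> k kl;
      solve_edge entry_A2_even|lia].
  move=> i il; have [->|] := eqVneq i l; last by move=> ?; apply: Sl; lia.
  apply: last; [lia|rewrite /dX; solve_ifs|move=> j jl jn; apply: Sl; lia].
- have S6 : S 6%N by apply: (edge 0).
  have S3 : S 3%N by apply: (edge 6).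
  have S2 : S 2%N by apply: (edge 3).
  have S1 : S 1%N by apply: (edge 2).
  have S4 : S 4%N by apply: (edge 3).
  have S5 : S 5%N by apply: (edge 4).
  by do 7?[case=> //].
- have S06 : forall i, (0 <= i <= 6)%N -> S i.
    by apply: (path 0 6) => //; do 7?[case=> //].
  have S7 : S 7%N by apply: (edge 3) => //; apply: S06.
  by move=> i il; have [->//|?] := eqVneq i 7%N; apply: S06; lia.
- have S07 : forall i, (0 <= i <= 7)%N -> S i.
    by apply: (path 0 7) => //; do 8?[case=> //].
  have S8 : S 8%N by apply: (edge 5) => //; apply: S07.
  by move=> i il; have [->//|?] := eqVneq i 8%N; apply: S07; lia.
- by move=> i il; apply: (path 0 4) => // {il}; do 5?[case=> //].
- by move=> i il; apply: (path 0 4) => // {il}; do 5?[case=> //].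
- by move=> i il; apply: (path 0 2) => // {il}; do 3?[case=> //].
- by move=> i il; apply: (path 0 2) => // {il}; do 3?[case=> //].
Qed.

End Generation.

(** * Connectedness of the diagram and uniqueness of the marks *)

Lemma entry_diag X i : cartan_entry X i i = 2.
Proof. by rewrite /cartan_entry eqxx. Qed.

Lemma entry_offdiag X i j : i != j -> cartan_entry X i j <= 0.
Proof.
rewrite /cartan_entry => /negPf->.
have : all (fun x => x.2 <= 0) (exceptional X).
  by case: X => [l|l|l|l|l|l|l|||||||] //=; case: l => [|[|l]].
elim: (exceptional X) => [|x s IH] /=; first by case: ifP.
by case: eqP => //= _ /andP[x0 /IH].
Qed.

Section Connected.
Variable X : affine_type.
Hypothesis adm : admissible X.
(** This is deduced later from the symmetry of the invariant form instead of a check type by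
    type. *)
Hypothesis adj_sym : forall i j, (i <= rk X)%N -> (j <= rk X)%N ->
  cartan_entry X i j != 0 -> cartan_entry X j i != 0.

(** Without a neighbour, the row of j would contribute 2 a_j to a sum that is zero. *)
Lemma exists_neighbour j : (j <= rk X)%N ->
  exists2 i, (i <= rk X)%N & (i != j) && (cartan_entry X j i != 0).
Proof.
move=> jl; apply: contrapT => H.
have := row_sum adm jl.
rewrite (@sum_support _ _ [:: j]) //; first last.
- move=> i il; rewrite inE => ij; rewrite /row_term.
  have [->|ne] := eqVneq (cartan_entry X j i) 0; first by rewrite mul0r.
  by case: H; exists i => //; rewrite ij.
- by rewrite /= ltnS jl.
rewrite big_cons big_nil /row_term entry_diag.
have := mark_gt0 jl; lia.
Qed.

(** Starting from the node 0, the walk of [generation] applies. A general start i0 is reduced to it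
    by contraposition, since the complement of S is also closed under adjacency. *)
Lemma connected (S : nat -> Prop) i0 : (i0 <= rk X)%N -> S i0 ->
  (forall i j, (i <= rk X)%N -> (j <= rk X)%N -> cartan_entry X i j != 0 ->
     S i -> S j) ->
  forall i, (i <= rk X)%N -> S i.
Proof.
have from0 (S' : nat -> Prop) : S' 0%N ->
    (forall i j, (i <= rk X)%N -> (j <= rk X)%N -> cartan_entry X i j != 0 ->
     S' i -> S' j) -> forall i, (i <= rk X)%N -> S' i.
  move=> S0 cl; apply: (generation adm) => //.
    move=> i j il jl e; apply: cl => //; first by lia.
    apply: adj_sym => //; first by lia.
    apply/eqP => e0; move: e; rewrite e0 mulr0.
    have jl' : (j <= rk X)%N by lia.
    have /andP[] := dX_dvd adm jl'; lia.
  (* Here every node other than j is already known, and j has a neighbour among them. *)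
  move=> j jl _ H.
  have [|i il /andP[ij e]] := @exists_neighbour j; first by lia.
  apply: (cl i j) => //; [lia|apply: adj_sym => //; lia|exact: H].
move=> il0 Si0 cl i il; apply: (from0 S) => //.
apply: contrapT => nS0; move: Si0; apply: (from0 (fun i => ~ S i)) => //.
move=> j k jl kl e nSj Sk; apply: nSj; apply: (cl k) => //; exact: adj_sym.
Qed.

End Connected.

Lemma kernel_unique (n : nat) (E : nat -> nat -> int) (x m : nat -> nat) (i1 : nat) :
  (forall i j, (i <= n)%N -> (j <= n)%N -> i != j -> E i j <= 0) ->
  (forall (S : nat -> Prop) i0, (i0 <= n)%N -> S i0 ->
    (forall i j, (i <= n)%N -> (j <= n)%N -> E i j != 0 -> S i -> S j) ->
    forall i, (i <= n)%N -> S i) ->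
  (forall i, (i <= n)%N -> 0 < m i)%N ->
  (forall i, (i <= n)%N -> \sum_(j < n.+1) E i j * (m j)%:Z = 0) ->
  (forall i, (i <= n)%N -> \sum_(j < n.+1) E i j * (x j)%:Z = 0) ->
  \big[gcdn/0%N]_(i < n.+1) x i = 1%N -> (i1 <= n)%N -> m i1 = 1%N ->
  forall i, (i <= n)%N -> x i = m i.
Proof.
move=> off con m0 Em Ex gx i1n mi1.
(* Minimum principle: at the nodes where x / m is minimal, the equation forces
   x / m to be minimal at the neighbours as well. *)
pose r (i : 'I_n.+1) : rat := (x i)%:R / (m i)%:R.
pose i0 := [arg min_(i < ord0) r i]%O.
have i0min (j : 'I_n.+1) : (x i0 * m j <= x j * m i0)%N.
  have : r i0 <= r j by rewrite /i0; case: arg_minP => // i _ /(_ j); apply.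
  rewrite /r ler_pdivrMr ?ltr0n ?m0 //; last by have := ltn_ord i0; lia.
  rewrite mulrAC ler_pdivlMr ?ltr0n ?m0 //; last by have := ltn_ord j; lia.
  by rewrite -!natrM ler_nat mulnC [X in (_ <= X)%N -> _]mulnC mulnC [X in (_ <=
    X)%N -> _]mulnC.
have i0n : (i0 <= n)%N by have := ltn_ord i0; lia.
(* Up to positive factors, y is x / m minus its minimum: a nonnegative kernel vector that vanishes
   at i0. *)
pose y j : int := (x j)%:Z * (m i0)%:Z - (x i0)%:Z * (m j)%:Z.
have y0 j : (j <= n)%N -> 0 <= y j.
  by move=> jn; have := i0min (Ordinal (jn : j < n.+1)%N); rewrite /y /=; lia.
have Ey i : (i <= n)%N -> \sum_(j < n.+1) E i j * y j = 0.
  move=> il; under eq_bigr => j _.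
    rewrite mulrBr mulrA (mulrC (x i0)%:Z) mulrA; over.
  by rewrite sumrB -!mulr_suml Em // Ex // !mul0r subrr.
have yall i : (i <= n)%N -> y i = 0.
  apply: (con (fun i => y i = 0) i0) => //; first by rewrite /y mulrC subrr.
  move=> i' j il jl Eij yi.
  have [<-//|ij] := eqVneq i' j.
  have := Ey i' il; have li : (i' < n.+1)%N by lia.
  have lj : (j < n.+1)%N by lia.
  rewrite (bigD1 (Ordinal li)) //= yi mulr0 add0r => /eqP.
  rewrite -oppr_eq0 -sumrN psumr_eq0.
    move=> /allP/(_ (Ordinal lj)); rewrite mem_index_enum => /(_ isT)/implyP/=.
    rewrite oppr_eq0 mulf_eq0 (negPf Eij) /= => H; apply/eqP/H.
    by apply/eqP => -[] /eqP; rewrite eq_sym (negPf ij).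
  move=> k ki; rewrite -mulNr mulr_ge0 ?oppr_ge0 //; last by apply: y0;
    have := ltn_ord k; lia.
  by apply: off => //; [have := ltn_ord k; lia|apply: contraNneq ki => e;
    apply/eqP/val_inj].
have prop i : (i <= n)%N -> (x i * m i0 = x i0 * m i)%N.
  by move=> /yall; rewrite /y; lia.
(* Since m is 1 at i1, x is an integral multiple of m; coprimality then forces the factor to be
   1. *)
have prop1 i : (i <= n)%N -> (x i = x i1 * m i)%N.
  move=> il; apply/eqP; rewrite -(eqn_pmul2r (m0 _ i0n)) prop // mulnAC prop //.
  by rewrite mi1 muln1.
have x1 : x i1 = 1%N.
  apply/eqP; rewrite -dvdn1 -gx; apply/dvdn_biggcdP => i _.
  by rewrite (prop1 i) ?dvdn_mulr //; have := ltn_ord i; lia.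
by move=> i il; rewrite prop1 // x1 mul1n.
Qed.

(** * Weights of an irreducible highest weight module *)

Section Ladder.
Variables (K : numFieldType) (V : lmodType K) (E F : V -> V).
Hypotheses (FZ : forall c v, F (c *: v) = c *: F v) (E0 : E 0 = 0).

(** Induction gives E F^{j+1} u = (j+1)(N-j) F^j u, and the coefficient is nonzero for j < N. *)
Lemma ladder_neq0 (u : V) (N : nat) : u != 0 -> E u = 0 ->
  (forall j, E (F (iter j F u)) = F (E (iter j F u)) + (N%:R - 2 * j%:R) *:
    iter j F u) ->
  forall j, (j <= N)%N -> iter j F u != 0.
Proof.
move=> u0 Eu EF.
have step j : E (iter j.+1 F u) = (j.+1%:R * (N%:R - j%:R)) *: iter j F u.
  have F0 : F 0 = 0 by rewrite -(scale0r 0) FZ !scale0r.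
  elim: j => [|j IH].
    by rewrite /= (EF 0%N) /= Eu F0 add0r; congr (_ *: _); ring.
  rewrite [LHS](EF j.+1) IH FZ -[F (iter j F u)]/(iter j.+1 F u) -scalerDl.
  by congr (_ *: _); rewrite -[j.+2]addn2 -[j.+1]addn1 !natrD; ring.
elim=> [//|j IH] jN; apply: contraTneq isT => fj.
have := step j; rewrite fj E0 => /esym/eqP.
rewrite scaler_eq0 (negPf (IH _)) 1?ltnW // orbF mulf_eq0 pnatr_eq0 /=.
by rewrite subr_eq0 eqr_nat => /eqP eN; rewrite eN ltnn in jN.
Qed.

End Ladder.

Section Representation.
Variables (R : realType) (X : affine_type) (G : affineKM R X).
Variable V : representation G.
Notation C := R[i].
Notation l := (rk X).
Notation wt := (weight G).
Implicit Types (x y : G) (u v : V) (c : C).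

Lemma actDr x u v : act x (u + v) = act x u + act x v.
Proof. by have := act_linearr x 1 u v; rewrite !scale1r. Qed.

Lemma act0r x : act x (0 : V) = 0.
Proof. by apply: (addrI (act x 0)); rewrite -actDr !addr0. Qed.

Lemma actZr x c u : act x (c *: u) = c *: act x u.
Proof. by have := act_linearr x c u 0; rewrite !addr0 act0r addr0. Qed.

Lemma actDl x y u : act (x + y) u = act x u + act y u.
Proof. by have := act_linearl u 1 x y; rewrite !scale1r. Qed.

Lemma act0l u : act 0 u = 0.
Proof. by apply: (addrI (act 0 u)); rewrite -actDl !addr0. Qed.

Lemma actZl c x u : act (c *: x) u = c *: act x u.
Proof. by have := act_linearl u c x 0; rewrite !addr0 act0l addr0. Qed.

Lemma actNl x u : act (- x) u = - act x u.
Proof. by rewrite -scaleN1r actZl scaleN1r. Qed.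

Lemma act_swap x y u : act x (act y u) = act y (act x u) + act (bracket x y) u.
Proof. by rewrite act_bracket addrC subrK. Qed.

Lemma weight_e i (mu : wt) v : weight_space mu v ->
  weight_space (mu + km_root G i) (act (km_e G i) v).
Proof.
move=> h x; rewrite act_swap km_he h actZr actZl -scalerDl.
by rewrite lfunE /= .
Qed.

Lemma weight_f i (mu : wt) v : weight_space mu v ->
  weight_space (mu - km_root G i) (act (km_f G i) v).
Proof.
move=> h x; rewrite act_swap km_hf h actZr actNl actZl -scaleNr -scalerDl.
by rewrite lfunE /= lfunE /=.
Qed.

Section String.
Variables (E F : V -> V) (beta : wt) (theta : wt -> C).
Hypotheses (FZ : forall c v, F (c *: v) = c *: F v) (E0 : E 0 = 0).
Hypothesis wE : forall mu v, weight_space mu v -> weight_space (mu + beta) (E v).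
Hypothesis wF : forall mu v, weight_space mu v -> weight_space (mu - beta) (F v).
Hypothesis EF : forall mu v, weight_space mu v -> E (F v) = F (E v) + theta mu *: v.
Hypothesis theta_beta : forall mu c, theta (mu + c *: beta) = theta mu + c * 2.
Hypothesis nilE : forall v, exists n, iter n E v = 0.

(** Let u = E^p v be the last nonzero vector of the E-string through v. Its weight mu + p beta has
    theta equal to m + 2p, so F^{p+t} u, of weight mu - t beta, is nonzero because p + t <= m + 2p.
    Leaving E and F abstract allows both (e_i, f_i) with beta = alpha_i and (f_i, e_i) with beta = -
    alpha_i. *)
Lemma weights_string mu (m t : nat) : weights V mu -> theta mu = m%:R ->
  (t <= m)%N -> weights V (mu - t%:R *: beta).
Proof.
case=> v wv v0 hm tm.
have ex : exists n, iter n E v == 0 by have [n hn] := nilE v; exists n; apply/eqP.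
case: (ex_minnP ex) => -[|p]; first by rewrite /= (negPf v0).
move=> /eqP Eu minp; set u := iter p E v.
have u0 : u != 0 by apply/negP => /minp; rewrite ltnn.
have wu : weight_space (mu + p%:R *: beta) u.
  rewrite /u; elim: p {Eu minp u u0} => [|p IH]; first by rewrite scale0r addr0.
  by rewrite -natr1 scalerDl scale1r addrA; apply: wE.
have wfu j : weight_space (mu + (p%:R - j%:R) *: beta) (iter j F u).
  elim: j => [|j IH]; first by rewrite subr0.
  by rewrite -natr1 opprD addrA scalerBl scale1r addrA; apply: wF.
exists (iter (p + t) F u).
  by have := wfu (p + t)%N; rewrite natrD opprD addrA subrr sub0r scaleNr.
apply: (@ladder_neq0 _ _ E F FZ E0 u (m + p.*2)) => //; last by lia.
move=> j; rewrite (EF (wfu j)) theta_beta hm; congr (_ + _ *: _).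
by rewrite natrD -mul2n natrM; ring.
Qed.

End String.

Lemma rootE mu i j (c : C) :
  (mu + c *: km_root G i : wt) (km_coroot G j)
    = mu (km_coroot G j) + c * (cartan X j i)%:~R.
Proof. by rewrite lfunE /= lfunE /= km_pairing. Qed.

Hypothesis intV : integrable V.

Lemma weights_sub_root i mu (m t : nat) : weights V mu ->
  mu (km_coroot G i) = m%:R -> (t <= m)%N -> weights V (mu - t%:R *: km_root G i).
Proof.
case: intV => _ nilE _.
apply: (@weights_string (act (km_e G i)) (act (km_f G i)) _ (fun mu : wt =>
  mu (km_coroot G i))).
- exact: actZr.
- exact: act0r.
- exact: weight_e.
- exact: weight_f.
- by move=> nu v wv; rewrite act_swap km_ef eqxx wv.
- by move=> nu c; rewrite rootE mxE /cartan_entry eqxx.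
- exact: nilE.
Qed.

Lemma weights_add_root i mu (m t : nat) : weights V mu ->
  mu (km_coroot G i) = - m%:R -> (t <= m)%N -> weights V (mu + t%:R *: km_root G i).
Proof.
case: intV => _ _ nilF wmu hm tm; rewrite -[_ *: _]opprK -scalerN.
apply: (@weights_string (act (km_f G i)) (act (km_e G i)) _
  (fun mu : wt => - mu (km_coroot G i))) wmu _ tm.
- exact: actZr.
- exact: act0r.
- exact: weight_f.
- by move=> nu v wv; rewrite opprK; apply: weight_e.
- move=> nu v wv; rewrite (act_swap (km_e G i)) km_ef eqxx wv scaleNr.
  by rewrite addrK.
- by move=> nu c; rewrite scalerN -scaleNr rootE mxE /cartan_entry eqxx opprD
  mulNr opprK.
- exact: nilF.
- by rewrite hm opprK.
Qed.

End Representation.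

(** * All weights lie below the highest weight *)

Section HighestWeight.
Variables (R : realType) (X : affine_type) (G : affineKM R X).
Variable V : representation G.
Notation C := R[i].
Notation l := (rk X).
Notation wt := (weight G).
Implicit Types (x y : G) (u v : V) (c : C).

Lemma lowerD Lam (b b' : {ffun 'I_l.+1 -> int}) :
  lower Lam (b + b') = lower Lam b - \sum_i (b' i)%:~R *: km_root G i.
Proof.
rewrite /lower -addrA -opprD -big_split /=; congr (_ - _); apply: eq_bigr => i _.
by rewrite ffunE rmorphD /= scalerDl.
Qed.

Lemma lower0 Lam : lower Lam (0 : {ffun 'I_l.+1 -> int}) = Lam :> wt.
Proof. by rewrite /lower big1 ?subr0 // => i _; rewrite ffunE scale0r. Qed.

Definition unit_coord (i : 'I_l.+1) : {ffun 'I_l.+1 -> int} := [ffun j => (j == i)%:Z].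

Lemma lowerD1 Lam b i (z : int) :
  lower Lam (b + unit_coord i *~ z) = lower Lam b - z%:~R *: km_root G i :> wt.
Proof.
have uE j : (unit_coord i *~ z) j = z * (j == i)%:Z.
  case: z => n; rewrite ?NegzE ?mulrNz ?ffunE -?pmulrn ffunMnE ffunE.
    by rewrite -mulr_natl natz.
  by rewrite -mulr_natl natz mulNr.
rewrite lowerD (bigD1 i) //= uE eqxx mulr1 big1 ?addr0 // => j ji.
by rewrite uE (negPf ji) mulr0 scale0r.
Qed.

Lemma lowerD1n Lam b i :
  lower Lam (b + unit_coord i) = lower Lam b - km_root G i :> wt.
Proof. by have := lowerD1 Lam b i 1; rewrite scale1r. Qed.

Lemma weight_spaceZ (mu : wt) c v : weight_space mu v -> weight_space mu (c *: v).
Proof. by move=> h x; rewrite actZr h !scalerA mulrC. Qed.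

(** Choose h separating mu from the weight nu of the first summand. The operator h - nu(h) kills
    that summand, preserves the weights of the others and multiplies u by a nonzero scalar, so
    induction on the number of summands applies. *)
Lemma weight_space_sum_eq0 (mu : wt) u (s : seq V) : weight_space mu u ->
  u = \sum_(r <- s) r ->
  (forall r, r \in s -> exists2 nu : wt, nu != mu & weight_space nu r) -> u = 0.
Proof.
have [n] := ubnP (size s).
elim: n s u => // n IH [|r s] u sn wu us ws; first by rewrite us big_nil.
have [nu numu wr] := ws r (mem_head _ _).
have [h hh] : exists h, nu h != mu h.
  apply: contrapT => H; move/eqP: numu; apply; apply/lfunP => h.
  by apply/eqP/negPn/negP => Hx; apply: H; exists h.
pose A v := act (km_emb G h) v - (nu h : C) *: v.
have wA (ka : wt) v : weight_space ka v -> A v = (ka h - nu h : C) *: v.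
  by move=> wv; rewrite /A wv scalerBl.
have AD : {morph A : v w / v + w}.
  by move=> v w; rewrite /A actDr scalerDr opprD addrACA.
have A0 : A 0 = 0 by rewrite /A act0r scaler0 subrr.
have /eqP : A u = 0.
  apply: (IH [seq A v | v <- s]).
  - by rewrite size_map.
  - by rewrite (wA _ _ wu); apply: weight_spaceZ.
  - rewrite us big_cons AD (wA _ _ wr) subrr scale0r add0r big_map.
    by rewrite (big_morph A AD A0).
  - move=> _ /mapP[v vs ->]; have [|ka kamu wv] := ws v; first by rewrite inE vs orbT.
    by exists ka => //; rewrite (wA _ _ wv); apply: weight_spaceZ.
by rewrite (wA _ _ wu) scaler_eq0 subr_eq0 eq_sym (negPf hh) => /eqP.
Qed.

Variables (Lam : wt) (v0 : V).
Hypotheses (irrV : irreducible V) (v0_neq0 : v0 != 0).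
Hypotheses (wv0 : weight_space Lam v0) (ev0 : forall i, act (km_e G i) v0 = 0).

Definition lowering_word (w : seq 'I_l.+1) : V :=
  foldr (fun i u => act (km_f G i) u) v0 w.

Definition lowering_span : set V :=
  [set u | forall U, subspace U -> (forall w, U (lowering_word w)) -> U u].

Lemma lowering_span_subspace : subspace lowering_span.
Proof.
split=> [U [] //|c u v hu hv U sU hU]; case: (sU) => _; apply; [exact: hu|exact: hv].
Qed.

Lemma lowering_span_word w : lowering_span (lowering_word w).
Proof. by move=> U _; apply. Qed.

Lemma lowering_span_act x : (forall w, lowering_span (act x (lowering_word w))) ->
  forall u, lowering_span u -> lowering_span (act x u).
Proof.
move=> H u /(_ [set u | lowering_span (act x u)]); apply => //.
have [s0 sD] := lowering_span_subspace.
split=> [|c a b ha hb] /=; first by rewrite act0r.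
by rewrite actDr actZr; apply: sD.
Qed.

Lemma lowering_word_weight w : exists2 b : {ffun 'I_l.+1 -> int}, (forall i, 0 <= b i) &
  weight_space (lower Lam b) (lowering_word w).
Proof.
elim: w => [|i w [b b0 wb]].
  by exists 0; [move=> i; rewrite ffunE|rewrite lower0].
exists (b + unit_coord i); first by move=> j; rewrite !ffunE addr_ge0.
by rewrite lowerD1n; apply: weight_f.
Qed.

(** The span of the words is stable under the f_i by construction, under h because words are weight
    vectors, and under the e_i by commuting e_i past each f_j down to v0. The elements of g
    preserving it form a subalgebra, hence all of g, and irreducibility applies. *)
Lemma lowering_span_full u : lowering_span u.
Proof.
have [s0 sD] := lowering_span_subspace.
have sZ c v : lowering_span v -> lowering_span (c *: v).
  by move=> hv; rewrite -[_ *: _]addr0; apply: sD.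
have sDD a b : lowering_span a -> lowering_span b -> lowering_span (a + b).
  by move=> ha hb; rewrite -[a]scale1r; apply: sD.
have actf i : forall u, lowering_span u -> lowering_span (act (km_f G i) u).
  by apply: lowering_span_act => w; apply: (lowering_span_word (i :: w)).
have acte i : forall u, lowering_span u -> lowering_span (act (km_e G i) u).
  apply: lowering_span_act; elim=> [|j w IH]; first by rewrite /= ev0.
  rewrite /= act_swap km_ef; apply: sDD; first exact: actf.
  case: eqP => _; last by rewrite act0l.
  have [b _ ->] := lowering_word_weight w; apply: sZ; exact: lowering_span_word.
have acth h : forall u, lowering_span u -> lowering_span (act (km_emb G h) u).
  apply: lowering_span_act => w; have [b _ ->] := lowering_word_weight w.
  apply: sZ; exact: lowering_span_word.
pose S := [set x | forall u, lowering_span u -> lowering_span (act x u)].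
have ST : S = setT.
  apply: km_gen => //; split; first split.
  - by move=> v _; rewrite act0l.
  - by move=> c x y hx hy v hv; rewrite actDl actZl; apply: sD; [apply: hx|apply: hy].
  - move=> x y hx hy v hv; rewrite act_bracket -scaleN1r addrC; apply: sD; auto.
have sub : submodule lowering_span.
  split=> // x v hv; have : S x by rewrite ST.
  exact.
case: irrV => _ /(_ _ sub)[] E; last by rewrite E.
have := lowering_span_word [::]; rewrite E /= => e0.
by move: v0_neq0; rewrite e0 eqxx.
Qed.

(** If mu were not of this form, every word, hence every vector, would be a sum of weight vectors of
    weights other than mu, so a vector of weight mu would vanish. *)
Lemma weights_lower mu : weights V mu ->
  exists2 b : {ffun 'I_l.+1 -> int}, (forall i, 0 <= b i) & mu = lower Lam b.
Proof.
case=> u wu u0; apply: contrapT => H; move/eqP: u0; apply.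
pose U := [set u | exists2 s : seq V, u = \sum_(r <- s) r &
   forall r, r \in s -> exists2 nu : wt, nu != mu & weight_space nu r].
have [] : U u; last by move=> s; apply: weight_space_sum_eq0.
apply: lowering_span_full; first split.
- by exists [::]; rewrite ?big_nil.
- move=> c a b [s -> hs] [t -> ht]; exists ([seq c *: r | r <- s] ++ t).
    by rewrite big_cat big_map -scaler_sumr.
  move=> r; rewrite mem_cat => /orP[/mapP[r' /hs[nu ? ?] ->]|/ht//].
  by exists nu => //; apply: weight_spaceZ.
move=> w; exists [:: lowering_word w]; first by rewrite big_seq1.
move=> r; rewrite inE => /eqP ->; have [b b0 wb] := lowering_word_weight w.
exists (lower Lam b) => //; apply/eqP => e; apply: H; by exists b.
Qed.

End HighestWeight.

(** * The affine Weyl group and its translations *)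

(* W stands for the dual of the Cartan subalgebra H, ev for the pairing, and P
   (below) for the set of weights of L(Lambda). *)
Section WeylGroup.
Variables (K : numFieldType) (X : affine_type) (W : lmodType K) (H : Type).
Hypothesis adm : admissible X.
Notation l := (rk X).
Variable ev : W -> H -> K.
Hypothesis evD : forall x y h, ev (x + y) h = ev x h + ev y h.
Hypothesis evZ : forall c x h, ev (c *: x) h = c * ev x h.
Hypothesis ev_inj : forall x y, (forall h, ev x h = ev y h) -> x = y.
Variables (root : 'I_l.+1 -> W) (coroot : 'I_l.+1 -> H).
Hypothesis pairing : forall i j, ev (root j) (coroot i) = (cartan X i j)%:~R.
Variables a av : 'I_l.+1 -> nat.
Hypotheses (ha : is_marks (cartan X) a) (hav : is_marks (cartan X)^T av).
Variable lev : W -> K.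
Hypothesis levE : forall x, lev x = \sum_i (av i)%:R * ev x (coroot i).
Variable form : W -> W -> K.
Hypothesis formDr : forall x y z, form x (y + z) = form x y + form x z.
Hypothesis formZr : forall x c y, form x (c *: y) = c * form x y.
Hypothesis formC : forall x y, form x y = form y x.
Hypothesis form_root : forall i eta,
  form (root i) eta = (av i)%:R / (a i)%:R * ev eta (coroot i).

Definition delta : W := \sum_i (a i)%:R *: root i.
Definition simple_refl i (eta : W) : W := eta - ev eta (coroot i) *: root i.
Definition translation (al eta : W) : W :=
  let m := lev eta in
  eta + m *: al - (form eta al + 2^-1 * form al al * m) *: delta.
Notation t_ := translation.

Lemma evN x h : ev (- x) h = - ev x h.
Proof. by rewrite -scaleN1r evZ mulN1r. Qed.

Lemma ev0 h : ev 0 h = 0.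
Proof. by rewrite -(scale0r 0) evZ mul0r. Qed.

Lemma ev_sum (I : finType) (P : pred I) (F : I -> W) h :
  ev (\sum_(i | P i) F i) h = \sum_(i | P i) ev (F i) h.
Proof. by apply: (big_morph (ev^~ h)) => [u v|]; rewrite ?evD ?ev0. Qed.

Definition evE := (evD, evN, evZ).

Lemma reflD i x y : simple_refl i (x + y) = simple_refl i x + simple_refl i y.
Proof. by apply: ev_inj => h; rewrite /simple_refl !evE; ring. Qed.

Lemma reflZ i c x : simple_refl i (c *: x) = c *: simple_refl i x.
Proof. by apply: ev_inj => h; rewrite /simple_refl !evE; ring. Qed.

Lemma refl_coroot i x : ev (simple_refl i x) (coroot i) = - ev x (coroot i).
Proof.
by rewrite /simple_refl !evE pairing mxE /cartan_entry eqxx; ring.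
Qed.

Lemma reflK i : involutive (simple_refl i).
Proof.
move=> x; rewrite {1}/simple_refl refl_coroot.
by apply: ev_inj => h; rewrite /simple_refl !evE; ring.
Qed.

Lemma form0r x : form x 0 = 0.
Proof. by apply: (addrI (form x 0)); rewrite -formDr !addr0. Qed.

Lemma formNr x y : form x (- y) = - form x y.
Proof. by rewrite -scaleN1r formZr mulN1r. Qed.

Lemma formDl x y z : form (x + y) z = form x z + form y z.
Proof. by rewrite !(formC _ z) formDr. Qed.

Lemma formZl x c y : form (c *: x) y = c * form x y.
Proof. by rewrite !(formC _ y) formZr. Qed.

Lemma formNl x y : form (- x) y = - form x y.
Proof. by rewrite !(formC _ y) formNr. Qed.

Lemma form_suml (I : finType) (P : pred I) (F : I -> W) y :
  form (\sum_(i | P i) F i) y = \sum_(i | P i) form (F i) y.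
Proof.
by apply: (big_morph (form^~ y)) => [u v|]; rewrite ?formDl // formC form0r.
Qed.

Lemma a_neq0 i : (a i)%:R != 0 :> K.
Proof. by case: ha => a0 _ _; rewrite pnatr_eq0 -lt0n. Qed.

Lemma av_neq0 i : (av i)%:R != 0 :> K.
Proof. by case: hav => a0 _ _; rewrite pnatr_eq0 -lt0n. Qed.

(** The symmetric number (alpha_i | alpha_j) is a positive multiple of a_ij. *)
Lemma cartan_adj_sym i j : (i <= l)%N -> (j <= l)%N ->
  cartan_entry X i j != 0 -> cartan_entry X j i != 0.
Proof.
move=> il jl; case: ha => a0 _ _; case: hav => av0 _ _.
have := formC (root (inord i)) (root (inord j)).
rewrite !form_root !pairing !mxE !inordK // => /eqP e.
apply: contra_neq => ji0; move: e; rewrite ji0 mulr0 !mulf_eq0 invr_eq0 !pnatr_eq0.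
by rewrite !eqn0Ngt a0 av0 /= intr_eq0 => /eqP.
Qed.

Lemma a_mark i : a i = mark X i.
Proof.
case: ha => a0 ga Aa.
(* The node supplied last has mark 1: it is 0 except in type A^(2)_(2l), where a_0 = 2 and a_l =
   1. *)
have := @kernel_unique l (cartan_entry X) (fun j => a (inord j)) (mark X)
  (if is_A_2_even X then l else 0%N) _ _ _ _ _ _ _ _ i (ltn_ord i).
rewrite inord_val; apply.
- by move=> p q _ _; exact: entry_offdiag.
- exact: (connected adm cartan_adj_sym).
- by move=> p; exact: mark_gt0.
- by move=> p; exact: row_sum.
- move=> p pl; have := Aa (inord p); apply: etrans; apply: eq_bigr => j _.
  by rewrite mxE inord_val inordK.
- by rewrite -[RHS]ga; apply: eq_bigr => j _; rewrite inord_val.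
- by case: ifP.
- by case: (X) => // n; rewrite /= eqxx.
Qed.

Lemma av_comark i : av i = comark X i.
Proof.
case: hav => av0 gav Aav.
have := @kernel_unique l (fun i j => cartan_entry X j i) (fun j =>
  av (inord j)) (comark X)
  0%N _ _ _ _ _ _ _ _ i (ltn_ord i).
rewrite inord_val; apply.
- by move=> p q _ _; rewrite eq_sym; exact: entry_offdiag.
- move=> S i0 i0l Si0 cl; apply: (connected adm cartan_adj_sym i0l) => // p q pl ql e.
  by apply: cl => //; apply: cartan_adj_sym.
- by move=> p; exact: comark_gt0.
- by move=> p; exact: col_sum.
- move=> p pl; have := Aav (inord p); apply: etrans; apply: eq_bigr => j _.
  by rewrite !mxE inord_val inordK.
- by rewrite -[RHS]gav; apply: eq_bigr => j _; rewrite inord_val.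
- by [].
- exact: comark0.
Qed.

Lemma levD x y : lev (x + y) = lev x + lev y.
Proof. by rewrite !levE -big_split; apply: eq_bigr => i _; rewrite evD mulrDr. Qed.
Lemma levZ c x : lev (c *: x) = c * lev x.
Proof. by rewrite !levE mulr_sumr; apply: eq_bigr => i _; rewrite evZ mulrCA. Qed.
Lemma levN x : lev (- x) = - lev x.
Proof. by rewrite -scaleN1r levZ mulN1r. Qed.

(** The form carries delta to c, since a_i (alpha_i | x) = a_i^vee <h_i, x>. *)
Lemma form_delta x : form delta x = lev x.
Proof.
rewrite levE /delta form_suml; apply: eq_bigr => i _.
by rewrite formZl form_root mulrA mulrCA mulfV ?a_neq0 // mulr1.
Qed.

Lemma delta_coroot i : ev delta (coroot i) = 0.
Proof.
rewrite /delta ev_sum; case: ha => _ _ /(_ i) Aa.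
under eq_bigr => j _ do rewrite evZ pairing mulrC.
have := congr1 (fun z : int => z%:~R : K) Aa; rewrite rmorph_sum /= => e;
  rewrite -[RHS](mulr0z 1) -e.
by apply: eq_bigr => j _; rewrite rmorphM.
Qed.

Lemma lev_root i : lev (root i) = 0.
Proof.
rewrite levE; case: hav => _ _ /(_ i) Aa.
have := congr1 (fun z : int => z%:~R : K) Aa; rewrite rmorph_sum /= => e;
  rewrite -[RHS](mulr0z 1) -e.
by apply: eq_bigr => j _; rewrite mxE rmorphM /= pairing mulrC.
Qed.

Lemma lev_delta : lev delta = 0.
Proof. by rewrite levE big1 // => i _; rewrite delta_coroot mulr0. Qed.

Lemma lev_refl i x : lev (simple_refl i x) = lev x.
Proof. by rewrite /simple_refl levD levN levZ lev_root mulr0 subr0. Qed.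

Lemma refl_delta i : simple_refl i delta = delta.
Proof. by rewrite /simple_refl delta_coroot scale0r subr0. Qed.

Lemma form_refl i x y : form (simple_refl i x) (simple_refl i y) = form x y.
Proof.
rewrite /simple_refl !(formDl, formDr, formNl, formNr, formZl, formZr).
rewrite (formC x (root i)) !form_root pairing mxE /cartan_entry eqxx.
by have := a_neq0 i; move=> ?; field.
Qed.

Lemma form_refl_swap i x y : form (simple_refl i x) y = form x (simple_refl i y).
Proof. by rewrite -[y in LHS](reflK i) form_refl. Qed.

Lemma translE g eta : t_ g eta = eta + lev eta *: g -
  (form eta g + 2^-1 * form g g * lev eta) *: delta.
Proof. by []. Qed.

Lemma transl0 eta : t_ 0 eta = eta.
Proof. by rewrite translE !form0r scaler0 mulr0 mul0r !addr0 scale0r subr0. Qed.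

Lemma lev_transl g eta : lev g = 0 -> lev (t_ g eta) = lev eta.
Proof. by move=> g0; rewrite translE !(levD, levN, levZ) g0 lev_delta !mulr0
  subr0 addr0. Qed.

Lemma translD g g' eta : lev g = 0 -> lev g' = 0 -> t_ g (t_ g' eta) = t_ (g + g') eta.
Proof.
move=> g0 g'0; rewrite translE lev_transl // (translE g' eta) (translE (g + g') eta).
rewrite !(formDl, formDr, formNl, formNr, formZl, formZr) form_delta g0 (formC g').
by apply: ev_inj => h; rewrite !evE; field.
Qed.

(** Simple reflections are isometries that fix delta and the level, so conjugating t_g by s_i gives
    the translation by s_i g. *)
Lemma refl_transl i g eta :
  simple_refl i (t_ g eta) = t_ (simple_refl i g) (simple_refl i eta).
Proof.
rewrite translE -scaleNr !reflD !reflZ refl_delta.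
by rewrite [RHS]translE lev_refl !form_refl scaleNr.
Qed.

Definition weyl_word (s : seq 'I_l.+1) (eta : W) : W := foldr simple_refl eta s.

Lemma weyl_word_cat s s' eta : weyl_word (s ++ s') eta = weyl_word s (weyl_word s' eta).
Proof. exact: foldr_cat. Qed.

Lemma weyl_word_revK s : cancel (weyl_word s) (weyl_word (rev s)).
Proof.
move=> eta; elim: s => [//|i s IH].
by rewrite rev_cons -cats1 weyl_word_cat /= reflK.
Qed.

Lemma weyl_wordD s x y : weyl_word s (x + y) = weyl_word s x + weyl_word s y.
Proof. by elim: s => //= i s ->; rewrite reflD. Qed.

Lemma weyl_wordZ s c x : weyl_word s (c *: x) = c *: weyl_word s x.
Proof. by elim: s => //= i s ->; rewrite reflZ. Qed.

Lemma weyl_word_delta s : weyl_word s delta = delta.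
Proof. by elim: s => //= i s ->; rewrite refl_delta. Qed.

Lemma weyl_word_transl s g eta :
  weyl_word s (t_ g eta) = t_ (weyl_word s g) (weyl_word s eta).
Proof. by elim: s => //= i s ->; rewrite refl_transl. Qed.

(** * Positivity of the form on the root lattice *)

Definition gram i j : K := (av i)%:R * (cartan X i j)%:~R * (a j)%:R.

Lemma form_roots i j : form (root i) (root j) = (av i)%:R / (a i)%:R * (cartan X
  i j)%:~R.
Proof. by rewrite form_root pairing. Qed.

Lemma gramC i j : gram i j = gram j i.
Proof.
have := formC (root i) (root j); rewrite !form_roots /gram => e.
have -> : (av i)%:R * (cartan X i j)%:~R * (a j)%:R =
  (av i)%:R / (a i)%:R * (cartan X i j)%:~R * ((a i)%:R * (a j)%:R) :> K.
  by have := a_neq0 i => ?; field.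
by rewrite e; have := a_neq0 j => ?; field.
Qed.

Lemma gram_sum i : \sum_j gram i j = 0.
Proof.
case: ha => _ _ /(_ i) Aa.
have := congr1 (fun z : int => z%:~R : K) Aa; rewrite rmorph_sum /= => e.
rewrite -[RHS](mulr0 (av i)%:R) -[X in _ * X](mulr0z 1) -e mulr_sumr.
by apply: eq_bigr => j _; rewrite /gram rmorphM /= mulrA.
Qed.

Lemma gram_le0 i j : i != j -> gram i j <= 0.
Proof.
move=> ij; rewrite /gram mulr_le0_ge0 ?ler0n // mulr_ge0_le0 ?ler0n //.
by rewrite lerz0 mxE entry_offdiag.
Qed.

Definition root_comb (x : 'I_l.+1 -> K) : W := \sum_i x i *: root i.

Lemma form_root_comb x eta : form (root_comb x) eta =
  \sum_i x i * ((av i)%:R / (a i)%:R * ev eta (coroot i)).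
Proof. by rewrite form_suml; apply: eq_bigr => i _; rewrite formZl form_root. Qed.

(** [gram i j] is (a_i alpha_i | a_j alpha_j), a symmetric matrix with zero row sums, like a graph
    Laplacian. When the squares are expanded, the pure squares cancel because of the row sums. *)
Lemma form_root_comb_sqr x : 2 * form (root_comb x) (root_comb x) =
  \sum_i \sum_j - gram i j * (x i / (a i)%:R - x j / (a j)%:R) ^+ 2.
Proof.
pose y i := x i / (a i)%:R.
have -> : form (root_comb x) (root_comb x) = \sum_i \sum_j gram i j * (y i * y j).
  rewrite form_root_comb; apply: eq_bigr => i _; rewrite /root_comb ev_sum !mulr_sumr.
  apply: eq_bigr => j _; rewrite evZ pairing /gram /y.
  by have := a_neq0 i => ?; have := a_neq0 j => ?; field; apply/andP.
transitivity (\sum_i \sum_j (gram i j * (y i * y j) * 2 - gram i j * y i ^+ 2 -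
  gram i j * y j ^+ 2)); last first.
  by apply: eq_bigr => i _; apply: eq_bigr => j _; rewrite /y; ring.
under [RHS]eq_bigr => i _ do rewrite !sumrB -mulr_suml -mulr_suml gram_sum mul0r subr0.
rewrite sumrB [X in _ - X]exchange_big /= [X in _ - X]big1 ?subr0 => [|j _]; last first.
  by rewrite -mulr_suml; under eq_bigr => i _ do rewrite gramC; rewrite gram_sum mul0r.
by rewrite -mulr_suml mulrC.
Qed.

Section Positivity.
Variable x : 'I_l.+1 -> K.
Hypothesis xR : forall i, x i \is Num.real.

Lemma form_root_comb_term_ge0 i j :
  0 <= - gram i j * (x i / (a i)%:R - x j / (a j)%:R) ^+ 2.
Proof.
have [->|ij] := eqVneq i j; first by rewrite subrr expr0n mulr0.
rewrite mulr_ge0 ?oppr_ge0 ?gram_le0 // real_exprn_even_ge0 //.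
by rewrite rpredB // rpred_div // realn.
Qed.

Lemma form_root_comb_ge0 : 0 <= form (root_comb x) (root_comb x).
Proof.
rewrite -(pmulr_rge0 _ (ltr0n K 2)) form_root_comb_sqr.
by do 2![apply: sumr_ge0 => ? _]; exact: form_root_comb_term_ge0.
Qed.

(** Every term of the sum of squares vanishes, so x_i / a_i agrees at adjacent nodes, and the
    diagram is connected. *)
Lemma form_root_comb_eq0 : form (root_comb x) (root_comb x) = 0 ->
  forall i, x i / (a i)%:R = x ord0 / (a ord0)%:R.
Proof.
move=> e0; have /eqP : \sum_i \sum_j - gram i j * (x i / (a i)%:R - x j / (a
  j)%:R) ^+ 2 = 0.
  by rewrite -form_root_comb_sqr e0 mulr0.
rewrite psumr_eq0 => [/allP z|i _]; last by apply: sumr_ge0 => ? _;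
  exact: form_root_comb_term_ge0.
have adj i j : cartan X i j != 0 -> x i / (a i)%:R = x j / (a j)%:R.
  move=> Aij; have := z i (mem_index_enum _); rewrite /= psumr_eq0; last first.
    by move=> ? _; exact: form_root_comb_term_ge0.
  move/allP/(_ j (mem_index_enum _)); rewrite /= mulf_eq0 oppr_eq0 !mulf_eq0.
  by rewrite (negPf (av_neq0 _)) (negPf (a_neq0 _)) intr_eq0 (negPf Aij) /= orbb
    subr_eq0 => /eqP.
pose S n := x (inord n) / (a (inord n))%:R = x ord0 / (a ord0)%:R.
have Sall : forall n, (n <= l)%N -> S n.
  apply: (connected adm cartan_adj_sym (leq0n l));
    first by rewrite /S -(inord_val ord0).
  move=> p q pl ql e Sp; rewrite /S -Sp; apply: adj.
  rewrite mxE !inordK //; exact: cartan_adj_sym.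
by move=> i; have := Sall i (ltn_ord i); rewrite /S inord_val.
Qed.

End Positivity.

(** * The lattice M and the vectors beta_i *)

Let d0 (i : 'I_l.+1) : nat := dX X i.
(* For j != 0, (beta_j | eta) = nn j <h_j, eta>. *)
Let nn (j : 'I_l.+1) : nat := ((d0 j * av j) %/ (a ord0 * a j))%N.

Lemma a_gt0 i : (0 < a i)%N. Proof. by case: ha. Qed.
Lemma av_gt0 i : (0 < av i)%N. Proof. by case: hav. Qed.

Lemma d0_gt0 i : (0 < d0 i)%N.
Proof. by have /andP[] := dX_dvd adm (ltn_ord i : (i <= l)%N). Qed.

Lemma d0_neq0 i : (d0 i)%:R != 0 :> K.
Proof. by rewrite pnatr_eq0 -lt0n d0_gt0. Qed.

Lemma d0_dvd i : (d0 i %| a i)%N.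
Proof. by rewrite a_mark; have /andP[] := dX_dvd adm (ltn_ord i : (i <= l)%N). Qed.

Lemma d0_ord0 : d0 ord0 = a ord0.
Proof. by rewrite a_mark. Qed.

(** In the first case [nn j] = 1, in the second [nn j] = a_j^vee / a_j; either way the division
    defining [nn] is exact. *)
Lemma d0_cases j : j != ord0 ->
  ((untwisted X || is_A_2_even X) /\ (d0 j * av j = a ord0 * a j)%N) \/
  (~~ (untwisted X || is_A_2_even X) /\ [/\ d0 j = 1%N, a ord0
    = 1%N & (a j %| av j)%N]).
Proof.
move=> j0; rewrite !a_mark !av_comark.
have jn0 : (j : nat) != 0%N := j0.
have jl : (0 < j <= l)%N by rewrite lt0n jn0 -ltnS ltn_ord.
case: (boolP (untwisted X || is_A_2_even X)) => t; [left|right]; split=> //.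
  exact: dX_comark.
split; [by rewrite /d0 /dX (negPf t) (negPf jn0)| |by apply: mark_dvd_comark =>
  //; case/andP: jl].
by move: t; rewrite negb_or mark0 // => /andP[_ /negPf->].
Qed.

Lemma nnE j : j != ord0 -> (d0 j * av j = nn j * (a ord0 * a j))%N.
Proof.
move=> j0; rewrite /nn divnK //.
by case: (d0_cases j0) => -[_] => [->//|[-> -> ?]]; rewrite !mul1n.
Qed.

Lemma nn_gt0 j : j != ord0 -> (0 < nn j)%N.
Proof.
move=> j0; have := nnE j0; have := d0_gt0 j; have := av_gt0 j.
by case: (nn j) => // av0 d0'; nia.
Qed.

(** As [d0 ord0] = a_0, this is alpha_0 - delta / a_0 at the node 0 and d_j alpha_j / a_0
    elsewhere. *)
Definition beta j : W :=
  ((d0 j)%:R / (a ord0)%:R) *: root j - ((j == ord0)%:R / (a ord0)%:R) *: delta.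

Lemma beta_node (i : 'I_l) :
  beta (@node X i) = ((d0 (@node X i))%:R / (a ord0)%:R) *: root (@node X i).
Proof. by rewrite /beta mul0r scale0r subr0. Qed.

Lemma form_beta j eta : j != ord0 -> form (beta j) eta = (nn j)%:R * ev eta (coroot j).
Proof.
move=> j0; rewrite /beta (negPf j0) mul0r scale0r subr0 formZl form_root.
have := congr1 (fun n : nat => n%:R : K) (nnE j0); rewrite !natrM => e.
transitivity ((d0 j)%:R * (av j)%:R / ((a ord0)%:R * (a j)%:R) * ev eta (coroot j)).
  by have := a_neq0 ord0 => ?; have := a_neq0 j => ?; field; apply/andP.
by rewrite e; have := a_neq0 ord0 => ?; have := a_neq0 j => ?; field; apply/andP.
Qed.

Lemma lev_beta j : lev (beta j) = 0.
Proof. by rewrite /beta levD levN !levZ lev_root lev_delta !mulr0 subr0. Qed.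

Lemma ev_beta i j : ev (beta i) (coroot j) = (d0 i)%:R / (a ord0)%:R * (cartan X
  j i)%:~R.
Proof. by rewrite /beta evD evN !evZ delta_coroot pairing mulr0 subr0. Qed.

Lemma refl_beta i j : j != ord0 ->
  simple_refl j (beta i) = beta i - ((d0 i)%:R * (cartan X j i)%:~R / (d0 j)%:R)
    *: beta j.
Proof.
move=> j0; rewrite /simple_refl ev_beta {3}/beta (negPf j0) mul0r scale0r subr0 scalerA.
congr (_ - _ *: _); have := a_neq0 ord0 => ?; have := d0_neq0 j => ?; field; exact/andP.
Qed.

(** Either d_j = 1, or [nn] is 1 at i and j and the symmetry of (beta_i | beta_j) shows that the
    quotient equals a_ij. *)
Lemma refl_coef_int i j : i != ord0 -> j != ord0 ->
  exists r : int, (d0 i)%:R * (cartan X j i)%:~R / (d0 j)%:R = r%:~R :> K.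
Proof.
move=> i0 j0; have dj := d0_neq0 j; have di := d0_neq0 i; have a00 := a_neq0 ord0.
case: (d0_cases j0) => -[t]; last first.
  by case=> -> _ _; exists ((d0 i)%:Z * cartan X j i); rewrite divr1 rmorphM.
case: (d0_cases i0) => -[t']; last by rewrite t in t'.
move=> ei ej; exists (cartan X i j).
have := formC (beta i) (beta j).
have nn1 k : k != ord0 -> (d0 k * av k = a ord0 * a k)%N -> nn k = 1%N.
  by move=> k0 ek; rewrite /nn ek divnn muln_gt0 !a_gt0.
rewrite !form_beta // !nn1 // !mul1r !ev_beta => e.
apply: (mulfI (mulf_neq0 dj (invr_neq0 a00))).
transitivity ((d0 i)%:R / (a ord0)%:R * (cartan X j i)%:~R : K).
  by field; exact/andP.
by rewrite -e; ring.
Qed.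

Definition lattice_vec (z : 'I_l -> int) : W := \sum_i (z i)%:~R *: beta (node i).
Definition in_lattice g := exists z, g = lattice_vec z.

Lemma in_lattice_D g g' : in_lattice g -> in_lattice g' -> in_lattice (g + g').
Proof.
case=> z -> [z' ->]; exists (fun i => z i + z' i); rewrite -big_split.
by apply: eq_bigr => i _; rewrite rmorphD scalerDl.
Qed.

Lemma in_lattice_Z g (n : int) : in_lattice g -> in_lattice (n%:~R *: g).
Proof.
case=> z ->; exists (fun i => n * z i); rewrite scaler_sumr.
by apply: eq_bigr => i _; rewrite rmorphM scalerA.
Qed.

Lemma in_lattice_N g : in_lattice g -> in_lattice (- g).
Proof. by move/(in_lattice_Z (-1)); rewrite mulrN1z scaleN1r. Qed.

Lemma in_lattice_0 : in_lattice 0.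
Proof. by exists (fun=> 0); rewrite /lattice_vec big1 // => i _; rewrite scale0r. Qed.

Lemma in_lattice_beta i : in_lattice (beta (node i)).
Proof.
exists (fun j => (j == i)%:Z); rewrite /lattice_vec (bigD1 i) //= eqxx scale1r.
by rewrite big1 ?addr0 // => j /negPf ->; rewrite scale0r.
Qed.

Lemma in_lattice_sum (I : finType) (P : pred I) (F : I -> W) :
  (forall i, P i -> in_lattice (F i)) -> in_lattice (\sum_(i | P i) F i).
Proof. by move=> h; apply: big_ind => //; [exact: in_lattice_0|exact:
  in_lattice_D]. Qed.

Lemma lev_in_lattice g : in_lattice g -> lev g = 0.
Proof.
case=> z ->; apply: (big_ind (fun g => lev g = 0)) => [|x y hx hy|i _].
- by rewrite -(scale0r 0) levZ mul0r.
- by rewrite levD hx hy addr0.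
- by rewrite levZ lev_beta mulr0.
Qed.

Lemma node_neq0 (i : 'I_l) : @node X i != ord0.
Proof. by rewrite eq_sym neq_lift. Qed.

Lemma node_surj j : j != ord0 -> exists i, j = @node X i.
Proof. by case: (unliftP ord0 j) => [i ->|-> //]; exists i. Qed.

Lemma refl_sum i (I : finType) (P : pred I) (F : I -> W) :
  simple_refl i (\sum_(j | P j) F j) = \sum_(j | P j) simple_refl i (F j).
Proof.
apply: (big_morph (simple_refl i)) => [x y|]; first exact: reflD.
by rewrite -(scale0r 0) reflZ !scale0r.
Qed.

Lemma in_lattice_refl j g : j != ord0 -> in_lattice g -> in_lattice (simple_refl j g).
Proof.
move=> j0 [z ->]; rewrite refl_sum; apply: in_lattice_sum => i _; rewrite reflZ.
apply: in_lattice_Z; rewrite refl_beta //; apply: in_lattice_D;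
  first exact: in_lattice_beta.
have [r ->] := refl_coef_int (node_neq0 i) j0; apply/in_lattice_N/in_lattice_Z.
by have [k ->] := node_surj j0; exact: in_lattice_beta.
Qed.

(** This is the definition of delta divided by a_0. *)
Lemma beta_relation : \sum_j (a j %/ d0 j)%N%:R *: beta j = 0.
Proof.
have dE j : (a j %/ d0 j)%N%:R * (d0 j)%:R = (a j)%:R :> K by rewrite -natrM
  divnK ?d0_dvd.
transitivity (\sum_j ((a ord0)%:R^-1 *: ((a j)%:R *: root j) -
    ((a j %/ d0 j)%N%:R * ((j == ord0)%:R / (a ord0)%:R)) *: delta)).
  by apply: eq_bigr => j _; rewrite /beta scalerBr !scalerA; congr (_ *: _ - _);
    rewrite mulrA dE mulrC.
rewrite sumrB -scaler_sumr -/delta (bigD1 ord0) //= d0_ord0 divnn a_gt0.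
rewrite big1 => [|j /negPf->]; last by rewrite mul0r mulr0 scale0r.
by rewrite !mul1r addr0 subrr.
Qed.

(* theta / a_0 *)
Definition gamma0 : W := - beta ord0.

Lemma gamma0E : gamma0 = \sum_(i < l) (a (@node X i) %/ d0 (@node X i))%N%:R *:
  beta (@node X i).
Proof.
have := beta_relation; rewrite big_ord_recl d0_ord0 divnn a_gt0 scale1r => /eqP.
by rewrite addr_eq0 /gamma0 => /eqP ->; rewrite opprK.
Qed.

Lemma in_lattice_gamma0 : in_lattice gamma0.
Proof. by rewrite gamma0E; apply: in_lattice_sum => i _;
  apply: (in_lattice_Z _%:Z); exact: in_lattice_beta. Qed.

Lemma form_gamma0 eta : form gamma0 eta = (lev eta) / (a ord0)%:R - ev eta
  (coroot ord0) / (a ord0)%:R.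
Proof.
rewrite /gamma0 /beta formNl formDl formNl !formZl eqxx form_root form_delta d0_ord0.
rewrite (av_comark ord0) comark0 /= mulr1n; have := a_neq0 ord0 => ?; by field.
Qed.

Lemma form_gamma0_gamma0 : form gamma0 gamma0 = 2 / (a ord0)%:R.
Proof.
rewrite form_gamma0 (lev_in_lattice in_lattice_gamma0) mul0r sub0r /gamma0 evN
  ev_beta d0_ord0.
by rewrite mxE /cartan_entry eqxx; have := a_neq0 ord0 => ?; field.
Qed.

(** This integer is a_0 (beta_i | beta_j). *)
Local Notation lform i j :=
  ((nn (@node X i))%:Z * (d0 (@node X j))%:Z * cartan X (@node X i) (@node X j)).

Definition lattice_form (z w : 'I_l -> int) : int := \sum_i \sum_j
  z i * w j * lform i j.

Lemma ev_lattice_vec w i : ev (lattice_vec w) (coroot i) =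
  \sum_j (w j)%:~R * ((d0 (node j))%:R / (a ord0)%:R * (cartan X i (node j))%:~R).
Proof. by rewrite ev_sum; apply: eq_bigr => j _; rewrite evZ ev_beta. Qed.

Lemma form_lattice_vec z w :
  (a ord0)%:R * form (lattice_vec z) (lattice_vec w) = (lattice_form z w)%:~R.
Proof.
rewrite form_suml mulr_sumr rmorph_sum; apply: eq_bigr => i _ /=.
rewrite formZl form_beta ?node_neq0 // ev_lattice_vec !mulr_sumr rmorph_sum.
apply: eq_bigr => j _ /=; rewrite !rmorphM /=.
by have := a_neq0 ord0 => ?; rewrite -!pmulrn; field.
Qed.

Lemma lattice_vec_comb z : lattice_vec z =
  root_comb (fun j => oapp (fun i => (z i)%:~R * ((d0 j)%:R / (a ord0)%:R)) 0
    (unlift ord0 j)).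
Proof.
rewrite /root_comb big_ord_recl unlift_none /= scale0r add0r; apply: eq_bigr => i _.
by rewrite liftK /= /beta (negPf (node_neq0 i)) mul0r scale0r subr0 scalerA.
Qed.

(** A null vector has coefficients proportional to the marks, but a vector of M has coefficient 0 at
    alpha_0. *)
Lemma lattice_form_gt0 z i : z i != 0 -> 0 < lattice_form z z.
Proof.
move=> zi; have a00 : 0 < (a ord0)%:R :> K by rewrite ltr0n a_gt0.
pose x j := oapp (fun i => (z i)%:~R * ((d0 j)%:R / (a ord0)%:R)) 0 (unlift ord0 j) : K.
have xR j : x j \is Num.real.
  by rewrite /x; case: unliftP => //= k _; rewrite rpredM ?realz // rpred_div ?realn.
rewrite -(ltr0z K) -form_lattice_vec pmulr_rgt0 // lattice_vec_comb -/x lt_def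
  form_root_comb_ge0 // andbT.
apply/eqP => /(form_root_comb_eq0 xR)/(_ (node i)).
rewrite {2}/x unlift_none /= mul0r /x liftK /= => /eqP.
rewrite !mulf_eq0 intr_eq0 (negPf zi) /= !invr_eq0.
by rewrite (negPf (d0_neq0 _)) !(negPf (a_neq0 _)).
Qed.

(** Equivalently, s_i g = g - e beta_i with e an integer. *)
Lemma in_lattice_coroot_int g i : in_lattice g -> exists e : int,
  ev g (coroot (node i)) = e%:~R * ((d0 (node i))%:R / (a ord0)%:R).
Proof.
case=> z ->; apply: (big_ind (fun g => exists e : int,
  ev g (coroot (node i)) = e%:~R * ((d0 (node i))%:R / (a ord0)%:R))).
- by exists 0; rewrite ev0 mul0r.
- by move=> x y [e he] [f hf]; exists (e + f); rewrite evD he hf rmorphD mulrDl.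
- move=> j _; have [r hr] := refl_coef_int (node_neq0 j) (node_neq0 i).
  exists (z j * r); rewrite evZ ev_beta rmorphM /= -hr.
  have := d0_neq0 (node i) => ?; have := a_neq0 ord0 => ?; field; exact/andP.
Qed.

(** * The reflection in theta belongs to the finite Weyl group *)

Definition fin_word (s : seq 'I_l) (eta : W) : W := foldr (fun i =>
  simple_refl (node i)) eta s.

Definition refl_vec g eta := eta - ((a ord0)%:R * form g eta) *: g.

Lemma sum_gt0_exists (I : finType) (F : I -> int) : 0 < \sum_i F i -> exists i, 0 < F i.
Proof.
move=> h; apply: contrapT => no; have : \sum_i F i <= 0; last by rewrite leNgt h.
by apply: sumr_le0 => i _; rewrite leNgt; apply/negP => Fi; apply: no; exists i.
Qed.

Lemma lattice_vecD1 z i (c : int) :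
  lattice_vec (fun k => z k + (k == i)%:Z * c) = lattice_vec z + c%:~R *: beta (node i).
Proof.
rewrite /lattice_vec (bigD1 i) //= [X in _ = X + _](bigD1 i) //= eqxx mul1r.
rewrite rmorphD scalerDl -!addrA; congr (_ + _); rewrite addrC; congr (_ + _).
by apply: eq_bigr => k /negPf->; rewrite mul0r addr0.
Qed.

Lemma form_addZ x c y :
  form (x + c *: y) (x + c *: y) = form x x + 2 * c * form y x + c ^+ 2 * form y y.
Proof. by rewrite !(formDl, formDr, formZl, formZr) (formC x y); ring. Qed.

(* The hypothesis on the norm says that refl_vec is a reflection, and is the
   smallest value the norm takes on M. *)
Lemma refl_vec_descent n z : (forall i, 0 <= z i) -> \sum_i z i <= n%:Z ->
  (a ord0)%:R * form (lattice_vec z) (lattice_vec z) = 2 ->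
  exists s, forall eta, fin_word s eta = refl_vec (lattice_vec z) eta.
Proof.
elim: n z => [|n IH] z z0 zn g2.
  have z00 i : z i = 0.
    have : \sum_i z i == 0 by rewrite eq_le zn sumr_ge0.
    by rewrite psumr_eq0 // => /allP/(_ i (mem_index_enum _))/eqP.
  have e0 : lattice_vec z = 0 by rewrite /lattice_vec big1 // => i _;
    rewrite z00 scale0r.
  by move/eqP: g2; rewrite e0 form0r mulr0 eq_sym pnatr_eq0.
have a00 := a_neq0 ord0.
have b2 : lattice_form z z = 2 by apply: (@intr_inj K); rewrite -form_lattice_vec g2.
(* The norm of gamma is positive, so some i has z_i (beta_i | gamma) > 0. Then z_i > 0 and e > 0,
   and passing from gamma to s_i gamma, with coordinates [z'], lowers the sum of the coordinates. *)
have [i zr] : exists i, 0 < z i * \sum_j z j * lform i j.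
  apply: sum_gt0_exists; have : 0 < lattice_form z z by rewrite b2.
  rewrite /lattice_form; under eq_bigr => i _ do
    (under eq_bigr => j _ do rewrite -mulrA; rewrite -mulr_sumr).
  by [].
pose g := lattice_vec z.
have [e he] : exists e : int, ev g (coroot (node i))
  = e%:~R * ((d0 (node i))%:R / (a ord0)%:R).
  by apply: in_lattice_coroot_int; exists z.
have dd0 : (0 < d0 (node i))%N by exact: d0_gt0.
have nn0 : (0 < nn (node i))%N by exact: nn_gt0 (node_neq0 i).
have hr : (nn (node i))%:Z * (e * (d0 (node i))%:Z) = \sum_j z j * lform i j.
  apply: (@intr_inj K); rewrite rmorphM rmorphM rmorph_sum /=.
  transitivity ((nn (node i))%:R * ((a ord0)%:R * ev g (coroot (node i)))).
    by rewrite he -!pmulrn; field.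
  rewrite ev_lattice_vec !mulr_sumr; apply: eq_bigr => j _;
    rewrite !rmorphM /= -!pmulrn.
  by field.
rewrite -hr in zr.
have zi : 0 < z i.
  by rewrite lt_neqAle z0 andbT eq_sym; apply: contraTneq zr => ->; rewrite mul0r ltxx.
have e0 : 0 < e by move: zr; rewrite pmulr_rgt0 // pmulr_rgt0 // pmulr_lgt0.
pose z' k := z k + (k == i)%:Z * - e.
have hz' : lattice_vec z' = simple_refl (node i) g.
  rewrite lattice_vecD1 /simple_refl he /beta (negPf (node_neq0 i)) mul0r scale0r subr0.
  by rewrite rmorphN scaleNr scalerA.
have g'2 : (a ord0)%:R * form (lattice_vec z') (lattice_vec z') = 2.
  by rewrite hz' form_refl.
have [z'i|z'i] := leP 0 (z' i).
  have [s hs] : exists s, forall eta, fin_word s eta = refl_vec (lattice_vec z') eta.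
    apply: IH => //.
      by move=> k; rewrite /z'; case: eqVneq => [->|_]; [move: z'i;
        rewrite /z' eqxx|rewrite mul0r addr0].
    have e1 : \sum_k (k == i)%:Z * - e = - e.
      rewrite (bigD1 i) //= eqxx mul1r big1 ?addr0 // => k /negPf ->.
      by rewrite mul0r.
    rewrite big_split /= e1.
    by rewrite lerBlDr (le_trans zn) //; lia.
  (* The reflection in gamma is the conjugate by s_i of the reflection in s_i gamma. *)
  exists (i :: s ++ [:: i]) => eta.
  rewrite /fin_word /= foldr_cat -/(fin_word _ _) /= hs /refl_vec hz'.
  by rewrite -scaleNr reflD reflZ !reflK scaleNr form_refl_swap reflK.
(* Here s_i gamma is lattice_vec zp minus a positive multiple of beta_i; unless
   zp = 0, the norm of this difference is too large. *)
pose zp k := z k + (k == i)%:Z * - z i.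
have zpi : zp i = 0 by rewrite /zp eqxx mul1r subrr.
have zpk k : k != i -> zp k = z k by move=> /negPf ki; rewrite /zp ki mul0r addr0.
have split_at c : lattice_vec (fun k => zp k + (k == i)%:Z * c)
  = lattice_vec zp + c%:~R *: beta (node i).
  exact: lattice_vecD1.
have [k /andP[ki zk]|zk0] := pickP (fun k => (k != i) && (z k != 0)).
  have e' : lattice_vec z' = lattice_vec zp + (z' i)%:~R *: beta (node i).
    rewrite -split_at; congr lattice_vec; apply/funext => m; rewrite /zp /z'.
    by case: eqVneq => [->|_]; rewrite ?eqxx ?mul0r ?mul1r; lia.
  have [M hM] : exists M : int, M = \sum_j zp j * lform i j.
    by exists (\sum_j zp j * lform i j).
  have M0 : M <= 0.
    rewrite hM; apply: sumr_le0 => j _; have [->|ji] := eqVneq j i;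
      first by rewrite zpi mul0r.
    rewrite zpk // mulr_ge0_le0 // mulr_ge0_le0 // mxE entry_offdiag //.
    by rewrite eq_sym; apply: contra ji => /eqP e1; apply/eqP/val_inj; case: e1.
  have MK : (a ord0)%:R * form (beta (node i)) (lattice_vec zp) = M%:~R.
    rewrite hM form_beta ?node_neq0 // ev_lattice_vec !mulr_sumr rmorph_sum.
    by apply: eq_bigr => j _; rewrite !rmorphM /= -!pmulrn; field.
  have [B hB] : exists B : int, B = 2 * (nn (node i))%:Z * (d0 (node i))%:Z by
    exists (2 * (nn (node i))%:Z * (d0 (node i))%:Z).
  have bbK : (a ord0)%:R * form (beta (node i)) (beta (node i)) = B%:~R.
    by rewrite hB form_beta ?node_neq0 // ev_beta mxE /cartan_entry eqxx !rmorphM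
      /= -!pmulrn; field.
  (* The three terms are at least 1, 0 and 2: the cross term multiplies two nonpositive numbers, and
     B >= 2. *)
  have : 2 = lattice_form zp zp + 2 * z' i * M + z' i ^+ 2 * B.
    apply: (@intr_inj K); rewrite !rmorphD !rmorphM /= -!MK -!bbK -form_lattice_vec.
    rewrite -[LHS]g'2 e' form_addZ; ring.
  have : 0 < lattice_form zp zp by apply: (@lattice_form_gt0 _ k); rewrite zpk.
  have : 2 <= B by rewrite hB; nia.
  have : 0 <= z' i * M by nia.
  have : 1 <= z' i ^+ 2 by rewrite expr2; nia.
  move: (z' i ^+ 2) => q q1 zM B2 bz; rewrite -mulrA => e2.
  have : 2 <= q * B by nia.
  by lia.
have gE : lattice_vec z = (z i)%:~R *: beta (node i).
  rewrite /lattice_vec (bigD1 i) //= big1 ?addr0 // => k ki.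
  by have := zk0 k; rewrite ki /= => /negbFE/eqP ->; rewrite scale0r.
(* For gamma = z_i beta_i the value 2 of a_0 (gamma | gamma) is 2 z_i^2 nn_i d_i, so all three
   factors are 1 and the reflection is s_i itself. *)
have nd1 : (z i) ^+ 2 * ((nn (node i))%:Z * (d0 (node i))%:Z) = 1.
  apply: (@mulfI _ 2) => //; apply: (@intr_inj K).
  rewrite -[in RHS](mulr1 2) [RHS]/(2%:~R) -[RHS]g2 gE formZl formZr form_beta
    ?node_neq0 // ev_beta mxE /cartan_entry eqxx.
  by rewrite !rmorphM /= -!pmulrn; field.
have zi1 : z i = 1 by nia.
have nd : (nn (node i))%:R * (d0 (node i))%:R = 1 :> K.
  by rewrite -natrM; have -> : (nn (node i) * d0 (node i) = 1)%N by move: nd1;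
    rewrite zi1; lia.
exists [:: i] => eta; rewrite /= /refl_vec gE zi1 scale1r form_beta ?node_neq0 //.
rewrite /simple_refl /beta (negPf (node_neq0 i)) mul0r scale0r subr0 scalerA.
congr (_ - _ *: _).
transitivity ((nn (node i))%:R * (d0 (node i))%:R * ev eta (coroot (node i))).
  by rewrite nd mul1r.
by field.
Qed.

Lemma fin_wordE s eta : fin_word s eta = weyl_word (map (@node X) s) eta.
Proof. by elim: s => //= i s ->. Qed.

Lemma fin_word_cat s s' eta : fin_word (s ++ s') eta = fin_word s (fin_word s' eta).
Proof. exact: foldr_cat. Qed.

Lemma in_lattice_fin_word s g : in_lattice g -> in_lattice (fin_word s g).
Proof. by move=> hg; elim: s => //= i s IH; apply: in_lattice_refl => //;
  exact: node_neq0. Qed.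

Lemma gamma0_reflection : exists s, forall eta, fin_word s eta = refl_vec gamma0 eta.
Proof.
pose z i := (a (@node X i) %/ d0 (@node X i))%N%:Z.
have gz : gamma0 = lattice_vec z by rewrite gamma0E.
rewrite gz; apply: (@refl_vec_descent (absz (\sum_i z i))).
- by [].
- by rewrite lez_abs.
- by rewrite -gz form_gamma0_gamma0; have := a_neq0 ord0 => ?; field.
Qed.

Lemma transl_gamma0 eta : t_ gamma0 (refl_vec gamma0 eta) = simple_refl ord0 eta.
Proof.
have a00 := a_neq0 ord0; have lg := lev_in_lattice in_lattice_gamma0.
rewrite translE /refl_vec levD levN levZ lg mulr0 subr0.
rewrite formDl formNl formZl (formC eta) form_gamma0_gamma0 form_gamma0.
apply: ev_inj => h; rewrite /simple_refl /gamma0 /beta eqxx d0_ord0 !evE /=.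
by field.
Qed.

(** * Translations by M lie in the Weyl group *)

Definition weyl_transl g := in_lattice g /\ exists s, forall eta, t_ g eta
  = weyl_word s eta.

Lemma weyl_translD g g' : weyl_transl g -> weyl_transl g' -> weyl_transl (g + g').
Proof.
case=> Mg [s hs] [Mg' [s' hs']]; split; first exact: in_lattice_D.
exists (s ++ s') => eta; rewrite -translD ?lev_in_lattice //.
by rewrite hs hs' weyl_word_cat.
Qed.

Lemma weyl_translN g : weyl_transl g -> weyl_transl (- g).
Proof.
case=> Mg [s hs]; split; first exact: in_lattice_N.
exists (rev s) => eta; rewrite -{1}(weyl_word_revK s (t_ (- g) eta)) -hs.
by rewrite translD ?lev_in_lattice //; [rewrite subrr transl0|exact: in_lattice_N].
Qed.

Lemma weyl_transl0 : weyl_transl 0.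
Proof. by split; [exact: in_lattice_0|exists [::] => eta; rewrite transl0]. Qed.

Lemma weyl_translZ g (n : int) : weyl_transl g -> weyl_transl (n%:~R *: g).
Proof.
have nat_case (m : nat) g' : weyl_transl g' -> weyl_transl (m%:R *: g').
  move=> hg; elim: m => [|m IH]; first by rewrite scale0r; exact: weyl_transl0.
  by rewrite -natr1 scalerDl scale1r; apply: weyl_translD.
case: n => m hg; first exact: nat_case.
by rewrite NegzE mulrNz scaleNr; apply/weyl_translN/nat_case.
Qed.

Lemma weyl_transl_refl j g : j != ord0 -> weyl_transl g -> weyl_transl
  (simple_refl j g).
Proof.
move=> j0 [Mg [s hs]]; split; first exact: in_lattice_refl.
exists (j :: s ++ [:: j]) => eta; rewrite /= weyl_word_cat /= -hs refl_transl.
by rewrite reflK.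
Qed.

Lemma weyl_transl_sum (I : finType) (P : pred I) (F : I -> W) :
  (forall i, P i -> weyl_transl (F i)) -> weyl_transl (\sum_(i | P i) F i).
Proof. by move=> h; apply: big_ind => //; [exact: weyl_transl0|exact:
  weyl_translD]. Qed.

(** The hypotheses of [generation] come from t_{gamma0} = s_0 s_theta, from conjugation together
    with additivity of translations, and from the relation between the beta_i, solved for the one
    with coefficient 1. *)
Lemma weyl_transl_beta i : weyl_transl (beta i).
Proof.
pose S n := weyl_transl (beta (inord n)).
suff h : forall n, (n <= l)%N -> S n.
  by have := h i (ltn_ord i); rewrite /S inord_val.
have inord_neq0 j : (0 < j <= l)%N -> (inord j : 'I_l.+1) != ord0.
  by move=> jl; apply/eqP => /(congr1 val); rewrite /= inordK; lia.
apply: (generation adm).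
- rewrite /S -[inord 0]/(inord (@ord0 l)) inord_val -[beta _]opprK.
  apply: weyl_translN; split; first exact: in_lattice_gamma0.
  have [s hs] := gamma0_reflection.
  (* Solving t_{gamma0} s_theta = s_0 for the translation: the reversed word is the inverse of
     s_theta. *)
  exists (ord0 :: rev (map (@node X) s)) => eta.
  rewrite /= -transl_gamma0 -hs fin_wordE; congr (t_ _ _).
  by have := weyl_word_revK (rev (map (@node X) s)) eta; rewrite revK.
- move=> p q pl ql e hp; rewrite /S.
  have qn0 := inord_neq0 q ql.
  have -> : beta (inord q) = simple_refl (inord q) (beta (inord p)) - beta (inord p).
    rewrite refl_beta // mxE /d0 !inordK //; last by lia.
    have dq := d0_neq0 (inord q); rewrite /d0 inordK in dq; last by lia.
    have -> : (dX X p)%:R * (cartan_entry X q p)%:~R / (dX X q)%:R = -1 :> K.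
      rewrite (_ : (dX X p)%:R * (cartan_entry X q p)%:~R = - (dX X q)%:R).
        by rewrite mulNr mulfV.
      by have := congr1 (fun z : int => z%:~R : K) e; rewrite rmorphM rmorphN.
    by rewrite scaleN1r opprK addrAC subrr add0r.
  by apply: weyl_translD; [apply: weyl_transl_refl|apply: weyl_translN].
- move=> q ql mq hq; rewrite /S.
  have qi : ((inord q : 'I_l.+1) = q :> nat) by rewrite inordK //; lia.
  have := beta_relation; rewrite (bigD1 (inord q)) //= a_mark /d0 qi mq divnn.
  have := d0_gt0 (inord q); rewrite /d0 qi => ->.
  rewrite scale1r => /eqP; rewrite addr_eq0 => /eqP ->.
  apply/weyl_translN/weyl_transl_sum => k kq; apply: (weyl_translZ _%:Z).
  rewrite -(inord_val k); apply: hq; first by rewrite -ltnS.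
  by apply: contraNneq kq => e; apply/eqP/val_inj; rewrite /= qi.
Qed.

Lemma in_lattice_weyl_transl g : in_lattice g -> exists s, forall eta, t_ g eta
  = weyl_word s eta.
Proof.
case=> z ->; suff [] : weyl_transl (lattice_vec z) by [].
by apply: weyl_transl_sum => i _; apply: weyl_translZ; exact: weyl_transl_beta.
Qed.

(** A letter s_0 equals t_{gamma0} s_theta. With u the product of s_theta and the finite part found
    so far, t_{gamma0} u = u t_{u^-1 gamma0}, and the two translations add up. *)
Lemma weyl_decomposition s : exists s0 g, in_lattice g /\
  forall eta, weyl_word s eta = fin_word s0 (t_ g eta).
Proof.
elim: s => [|i s [s0 [g [Mg IH]]]].
  by exists [::], 0; split=> [|eta]; [exact: in_lattice_0|rewrite transl0].
have [->|i0] := eqVneq i ord0; last first.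
  have [k ->] := node_surj i0; exists (k :: s0), g; split=> // eta.
  by rewrite /= IH.
have [sg hg] := gamma0_reflection; pose u := sg ++ s0.
exists u, (fin_word (rev u) gamma0 + g); split.
  by apply: in_lattice_D => //; apply: in_lattice_fin_word; exact: in_lattice_gamma0.
move=> eta; rewrite /= -transl_gamma0 -hg IH -fin_word_cat -/u.
rewrite -translD ?lev_in_lattice //; last by apply: in_lattice_fin_word;
  exact: in_lattice_gamma0.
rewrite [RHS]fin_wordE weyl_word_transl -!fin_wordE; congr (t_ _ _).
rewrite !fin_wordE map_rev.
by have := weyl_word_revK (rev (map (@node X) u)) gamma0; rewrite revK.
Qed.

(** * The set of weights modulo translations *)

Section WeightSet.
Hypothesis root_free : forall x, root_comb x = 0 -> forall i, x i = 0.
Variables (Lam : W) (k : nat).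
Hypotheses (k_gt0 : (0 < k)%N) (lev_Lam : lev Lam = k%:R).
Hypothesis dom_Lam : forall i, exists n : nat, ev Lam (coroot i) = n%:R.
Variable P : W -> Prop.

Definition lowered (b : {ffun 'I_l.+1 -> int}) : W := Lam - \sum_i (b i)%:~R *: root i.

Hypothesis P_lower : forall mu, P mu ->
  exists2 b : {ffun 'I_l.+1 -> int}, (forall i, 0 <= b i) & mu = lowered b.
Hypothesis P_Lam : P Lam.
Hypothesis P_sub : forall i mu (m t : nat), P mu -> ev mu (coroot i) = m%:R ->
  (t <= m)%N -> P (mu - t%:R *: root i).
Hypothesis P_add : forall i mu (m t : nat), P mu -> ev mu (coroot i) = - m%:R ->
  (t <= m)%N -> P (mu + t%:R *: root i).

Let unit_c (i : 'I_l.+1) (z : int) : {ffun 'I_l.+1 -> int} := [ffun j =>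
  (j == i)%:Z * z].

Lemma loweredD b b' : lowered (b + b') = lowered b - \sum_i (b' i)%:~R *: root i.
Proof.
rewrite /lowered -addrA -opprD -big_split /=; congr (_ - _); apply: eq_bigr => i _.
by rewrite ffunE rmorphD /= scalerDl.
Qed.

Lemma lowered_unit b i z : lowered (b + unit_c i z) = lowered b - z%:~R *: root i.
Proof.
rewrite loweredD (bigD1 i) //= ffunE eqxx mul1r big1 ?addr0 // => j /negPf ji.
by rewrite ffunE ji mul0r scale0r.
Qed.

Lemma lowered_inj : injective lowered.
Proof.
move=> b b' /addrI/oppr_inj e; apply/ffunP => i; apply/eqP.
rewrite -(eqr_int K) -subr_eq0; apply/eqP.
apply: (@root_free (fun i => (b i)%:~R - (b' i)%:~R)).
rewrite /root_comb; under eq_bigr => j _ do rewrite scalerBl.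
by rewrite sumrB e subrr.
Qed.

Lemma lowered_delta b (z : int) : lowered b + z%:~R *:
  delta = lowered (b - [ffun i => (a i)%:Z * z]).
Proof.
rewrite loweredD /delta scaler_sumr -sumrN; congr (_ + _); apply: eq_bigr => i _.
by rewrite !ffunE rmorphN scaleNr opprK scalerA rmorphM /= -pmulrn mulrC.
Qed.

Lemma ev_lowered b i : exists p : int, ev (lowered b) (coroot i) = p%:~R.
Proof.
have [n hn] := dom_Lam i.
exists (n%:Z - \sum_j b j * cartan X i j).
rewrite evD evN ev_sum hn rmorphB rmorph_sum; congr (_ - _); apply: eq_bigr => j _.
by rewrite evZ pairing rmorphM.
Qed.

Lemma lev_lowered b : lev (lowered b) = k%:R.
Proof.
rewrite levD levN lev_Lam (_ : lev (\sum_i _) = 0) ?subr0 //.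
apply: (big_ind (fun x => lev x = 0)) => [|x y hx hy|i _].
- by rewrite -(scale0r 0) levZ mul0r.
- by rewrite levD hx hy addr0.
- by rewrite levZ lev_root mulr0.
Qed.

Lemma lowered_weyl_word s b : exists b', weyl_word s (lowered b) = lowered b'.
Proof.
elim: s => [|i s [b' IH]]; first by exists b.
have [p hp] := ev_lowered b' i; exists (b' + unit_c i p).
by rewrite /= IH lowered_unit /simple_refl hp.
Qed.

Lemma P_refl i mu : P mu -> P (simple_refl i mu).
Proof.
move=> Pmu; have [b _ hb] := P_lower Pmu; have [p hp] := ev_lowered b i.
rewrite -hb in hp; rewrite /simple_refl hp; case: p hp => m hm.
  exact: (P_sub Pmu hm).
by rewrite NegzE mulrNz scaleNr opprK; apply: (P_add Pmu _ (leqnn _));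
  rewrite hm NegzE mulrNz.
Qed.

Lemma P_weyl_word s mu : P mu -> P (weyl_word s mu).
Proof. by move=> Pmu; elim: s => //= i s; exact: P_refl. Qed.

(** * Dominant weights and stability under subtracting delta *)

Definition dominant mu := forall i, exists n : nat, ev mu (coroot i) = n%:R.

(** Reflecting where <h_i, mu> < 0 lowers the height of Lam - mu, which stays nonnegative because
    the image is again a weight. *)
Lemma P_dominant_conj mu : P mu -> exists s, dominant (weyl_word s mu).
Proof.
move=> Pmu; have [b b0 hb] := P_lower Pmu; subst mu.
have [n] := ubnP (absz (\sum_i b i)); elim: n b b0 Pmu => // n IH b b0 Pb bn.
have [d|] := pselect (dominant (lowered b)); first by exists [::].
move=> /existsNP[i hi]; have [p hp] := ev_lowered b i.
have p0 : p < 0.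
  by case: p hp => // m hm; case: hi; exists m.
have Pr := P_refl i Pb; have [b' b'0 hb'] := P_lower Pr.
have e : b' = b + unit_c i p by apply: lowered_inj;
  rewrite -hb' lowered_unit /simple_refl hp.
have [||s hs] := IH b' b'0; first by rewrite -hb'.
  have sb : \sum_j b' j = \sum_j b j + p.
    rewrite e; under eq_bigr => j _ do rewrite !ffunE.
    rewrite big_split /=; congr (_ + _).
    rewrite (bigD1 i) //= ?eqxx ?mul1r big1 ?addr0 // => j /negPf->.
    by rewrite mul0r.
  have : 0 <= \sum_j b j by apply: sumr_ge0.
  have : 0 <= \sum_j b' j by apply: sumr_ge0.
  lia.
by exists (s ++ [:: i]); rewrite weyl_word_cat /= hb'.
Qed.

(* If kappa = mu - lambda is a multiple of delta, then (kappa | kappa) = 0 and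
   positivity of (lambda | kappa) comes from that of the level. *)
Lemma dominance b b' : P (lowered b) -> dominant (lowered b') -> (forall i, b i
  <= b' i) ->
  P (lowered b').
Proof.
move=> Pb dom bb'; have [n] := ubnP (absz (\sum_i (b' i - b i))).
elim: n b Pb bb' => // n IH b Pb bb' bn.
pose x i : K := (b' i)%:~R - (b i)%:~R.
have xR i : x i \is Num.real by rewrite rpredB ?realz.
have x0 i : 0 <= x i by rewrite subr_ge0 ler_int.
have [e|ne] := eqVneq b b'; first by rewrite -e.
have muE : lowered b = lowered b' + root_comb x.
  rewrite /lowered /root_comb /x; under [X in _ = _ + X]eq_bigr =>
    i _ do rewrite scalerBl.
  by rewrite sumrB addrA subrK.
(* With mu = lambda + kappa, (kappa | mu) is the sum of (kappa | lambda) and (kappa | kappa), both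
   nonnegative and not both zero. *)
have f0 : 0 < form (root_comb x) (lowered b).
  rewrite muE formDr.
  have h1 : 0 <= form (root_comb x) (lowered b').
    rewrite form_root_comb sumr_ge0 // => i _; have [m ->] := dom i.
    by rewrite !mulr_ge0 ?invr_ge0 ?ler0n.
  have h2 := form_root_comb_ge0 xR.
  rewrite lt_def addr_ge0 // andbT; apply/negP;
    rewrite paddr_eq0 // => /andP[/eqP e1 /eqP e2].
  have e3 := form_root_comb_eq0 xR e2; set c := x ord0 / _ in e3.
  have xE i : x i = c * (a i)%:R.
    by rewrite -(e3 i) divfK ?a_neq0.
  have vE : root_comb x = c *: delta.
    by rewrite /root_comb /delta scaler_sumr; apply: eq_bigr => i _; rewrite xE scalerA.
  move: e1; rewrite vE formZl form_delta lev_lowered => /eqP.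
  rewrite mulf_eq0 pnatr_eq0 eqn0Ngt k_gt0 orbF => /eqP c0.
  move/eqP: ne; apply; apply/ffunP => i; apply/eqP;
    rewrite eq_sym -(eqr_int K) -subr_eq0.
  by rewrite -/(x i) xE c0 mul0r.
(* Some term of the expansion of (kappa | mu) is positive. For this i, mu - alpha_i is a weight and
   still lies above lambda. *)
have [i [xi [p [p0 hp]]]] : exists i, b i < b' i /\ exists p :
  int, 0 < p /\ ev (lowered b) (coroot i) = p%:~R.
  apply: contrapT => no; move: f0; rewrite form_root_comb; apply/negP.
  suff : \sum_i x i * ((av i)%:R / (a i)%:R * ev (lowered b) (coroot i)) <= 0.
    by move=> h; apply/negP => /lt_le_trans/(_ h); rewrite ltxx.
  apply: sumr_le0 => i _; have [p hp] := ev_lowered b i.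
  have [e|xi] := eqVneq (b i) (b' i); first by rewrite /x e subrr mul0r.
  rewrite mulr_ge0_le0 // mulr_ge0_le0 ?divr_ge0 ?ler0n // hp lerz0 leNgt.
  apply/negP => p0; apply: no; exists i; split; last by exists p.
  by rewrite lt_neqAle xi bb'.
apply: (IH (b + unit_c i 1)).
- rewrite lowered_unit; apply: (@P_sub i _ (absz p) 1) => //; last by lia.
  by rewrite hp -[in LHS](gtz0_abs p0) -pmulrn.
- move=> j; rewrite !ffunE; case: eqVneq => [->|_]; last by rewrite mul0r addr0.
  by rewrite mulr1 lezD1.
- have sb : \sum_j (b' j - (b + unit_c i 1) j) = \sum_j (b' j - b j) - 1.
    under eq_bigr => j _ do rewrite !ffunE opprD addrA.
    rewrite sumrB; congr (_ - _).
    rewrite (bigD1 i) //= ?eqxx big1 ?addr0 // => j /negPf->.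
    by rewrite mul0r.
  have h0 : 0 <= \sum_(j | j != i) (b' j - b j).
    by apply: sumr_ge0 => j _; rewrite subr_ge0.
  rewrite sb; move: bn h0 xi; rewrite (bigD1 i) //=. move: (\sum_(j | j != i) _) => S0.
  lia.
Qed.

(** Conjugate mu to a dominant weight; subtracting delta keeps it dominant, so [dominance] applies,
    and delta is fixed when conjugating back. *)
Lemma P_sub_delta mu : P mu -> P (mu - delta).
Proof.
move=> Pmu; have [s ds] := P_dominant_conj Pmu.
have Ps := P_weyl_word s Pmu; have [b b0 hb] := P_lower Ps.
have e : weyl_word s mu - delta = lowered (b + [ffun i => (a i)%:Z]).
  have := lowered_delta b (-1); rewrite rmorphN scaleNr scale1r -hb => ->.
  by congr lowered; apply/ffunP => i; rewrite !ffunE mulrN1 opprK.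
rewrite -(weyl_word_revK s (mu - delta)); apply: P_weyl_word.
rewrite weyl_wordD -[- delta]scaleN1r weyl_wordZ weyl_word_delta scaleN1r e.
apply: (@dominance b); first by rewrite -hb.
- by move=> i; have [n hn] := ds i; exists n; rewrite -e evD evN delta_coroot subr0.
- by move=> i; rewrite !ffunE lerDl.
Qed.

Lemma P_sub_deltan mu n : P mu -> P (mu - n%:R *: delta).
Proof.
move=> Pmu; elim: n => [|n IH]; first by rewrite scale0r subr0.
by rewrite -natr1 scalerDl scale1r opprD addrA; apply: P_sub_delta.
Qed.

Definition maximal mu := P mu /\ ~ P (mu + delta).

(** The weights in mu + Z delta are closed under subtracting delta, so at most one of them is
    maximal. *)
Lemma maximal_unique mu (s : int) : maximal mu -> maximal (mu + s%:~R *: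
  delta) -> s = 0.
Proof.
have aux nu (n : nat) : maximal nu -> P (nu + n%:R *: delta) -> n = 0%N.
  case: n => // n [_ nP] Pn; case: nP.
  have := P_sub_deltan n Pn; congr P; apply: ev_inj => h.
  by rewrite !evE -natr1; ring.
case: s => n hmu hs; first by rewrite (aux mu n hmu (proj1 hs)).
have := aux _ n.+1 hs; rewrite NegzE mulrNz scaleNr subrK => /(_ (proj1 hmu)).
by [].
Qed.

Lemma maximal_weyl_word s mu : maximal mu -> maximal (weyl_word s mu).
Proof.
case=> Pmu nP; split; first exact: P_weyl_word.
move=> /(P_weyl_word (rev s)); rewrite weyl_wordD weyl_word_delta.
by rewrite weyl_word_revK.
Qed.

Lemma transl_addl g nu x : lev x = 0 -> t_ g (nu + x) = t_ g nu + x - form x g *: delta.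
Proof.
move=> x0; rewrite !translE levD x0 addr0 formDl.
by apply: ev_inj => h; rewrite !evE; ring.
Qed.

(** * Existence of weights and maximal weights modulo delta *)

Lemma ev_transl g eta j :
  ev (t_ g eta) (coroot j) = ev eta (coroot j) + lev eta * ev g (coroot j).
Proof. by rewrite translE !evE delta_coroot mulr0 subr0. Qed.

(** The factor a_0 clears the denominator of <h_j, beta_j> = 2 d_j / a_0. *)
Lemma P_translate j mu (N : int) : P mu -> exists p q : int,
  [/\ ev mu (coroot j) = p%:~R, P (t_ ((N * (a ord0)%:Z)%:~R *: beta j) mu),
   ev (t_ ((N * (a ord0)%:Z)%:~R *: beta j) mu) (coroot j) = q%:~R &
   q = p + N * (k%:Z * 2 * (d0 j)%:Z)].
Proof.
move=> Pmu; have [b _ hb] := P_lower Pmu; have [p hp] := ev_lowered b j.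
exists p, (p + N * (k%:Z * 2 * (d0 j)%:Z)); rewrite hb; split=> //.
  have [s hs] := proj2 (weyl_translZ (N * (a ord0)%:Z) (weyl_transl_beta j)).
  by rewrite hs; apply: P_weyl_word; rewrite -hb.
rewrite ev_transl hp lev_lowered evZ ev_beta.
rewrite mxE /cartan_entry eqxx rmorphD !rmorphM /= -!pmulrn.
by have := a_neq0 ord0 => ?; field.
Qed.

(* A translation by a large multiple of beta_j gives <h_j, mu> the sign for which
   the sl_2-string through mu has a next element. *)
Lemma P_add_root j mu (e : bool) : P mu ->
  exists c, P (mu + (-1) ^+ e *: root j + c *: delta).
Proof.
move=> Pmu.
have [b _ hb] := P_lower Pmu; have [p hp] := ev_lowered b j; rewrite -hb in hp.
(* Since |N| > |p|, the sign of q is that of N: positive when alpha_j is to be subtracted, negative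
   when it is to be added. *)
pose N : int := (-1) ^+ (~~ e) * (`|p| + 1).
have [p' [q [hp' Pt hq qE]]] := P_translate j N Pmu.
have pp' : p' = p by apply: (@intr_inj K); rewrite -hp -hp'.
set g := (_ *: beta j) in Pt hq.
have kd : 1 <= k%:Z * (d0 j)%:Z by have := d0_gt0 j; nia.
have Px : P (t_ g mu + (-1) ^+ e *: root j).
  rewrite /N in qE; case: (e) qE => /= qE.
    rewrite expr1 scaleN1r -[root j]scale1r.
    have q0 : 0 < q by rewrite qE pp' expr0 mul1r; nia.
    apply: (@P_sub j _ (absz q) 1) => //; last by lia.
    by rewrite hq -[in LHS](gtz0_abs q0).
  have q0 : q < 0 by rewrite qE pp' expr1; nia.
  apply: (@P_add j _ (absz q) 1) => //; last by lia.
  by rewrite hq -[q in LHS]opprK -(ltz0_abs q0) rmorphN.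
(* As alpha_j has level 0, translating back changes it only by a multiple of delta. *)
have [s hs] := proj2 (weyl_translN (weyl_translZ (N * (a ord0)%:Z)
  (weyl_transl_beta j))).
have := P_weyl_word s Px; rewrite -hs -/g.
have lg : lev g = 0 by rewrite levZ lev_beta mulr0.
rewrite transl_addl; last by rewrite levZ lev_root mulr0.
rewrite translD // ?levN ?lg ?oppr0 // addNr transl0 -scaleNr => h.
by eexists; exact: h.
Qed.

Lemma coset_P b : exists c, P (lowered b + c *: delta).
Proof.
pose E x := exists c, P (x + c *: delta).
have E1 j x (e : bool) : E x -> E (x + (-1) ^+ e *: root j).
  case=> c /(P_add_root j e)[c' h]; exists (c + c').
  by move: h; congr P; apply: ev_inj => x'; rewrite !evE; ring.
have En j x (e : bool) (n : nat) : E x -> E (x + n%:R *: ((-1) ^+ e *: root j)).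
  move=> Ex; elim: n => [|n IH]; first by rewrite scale0r addr0.
  by rewrite -natr1 scalerDl scale1r addrA; apply: E1.
have Ez j x (z : int) : E x -> E (x - z%:~R *: root j).
  case: z => n Ex; first by have := En j x true n Ex; rewrite expr1 scaleN1r scalerN.
  by have := En j x false n.+1 Ex; rewrite expr0 scale1r NegzE mulrNz scaleNr opprK.
suff h (r : seq 'I_l.+1) : E (Lam - \sum_(i <- r) (b i)%:~R *: root i) by exact: h.
elim: r => [|i r IH].
  by exists 0; rewrite big_nil subr0 scale0r addr0.
by rewrite big_cons opprD [- _ - _]addrC addrA; apply: Ez.
Qed.

Definition Ntilde eta := exists s mu, (maximal mu /\ dominant mu) /\ eta
  = fin_word s mu.

Lemma Ntilde_maximal eta : Ntilde eta -> maximal eta.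
Proof. by case=> s [mu [[h _] ->]]; rewrite fin_wordE; exact: maximal_weyl_word. Qed.

Lemma exists_maximal nu : P nu -> exists n : nat, maximal (nu + n%:R *: delta).
Proof.
move=> Pnu; apply: contrapT => no.
have Pn n : P (nu + n%:R *: delta).
  elim: n => [|n IH]; first by rewrite scale0r addr0.
  apply: contrapT => nP; apply: no; exists n; split=> //.
  by rewrite -[X in _ + X]scale1r -addrA -scalerDl natr1.
have [b b0 hb] := P_lower Pnu.
(* Adding (b_0 + 1) delta makes the coefficient of alpha_0 in Lam - nu equal to b_0 - (b_0 + 1) a_0
   < 0. *)
have := Pn (absz (b ord0)).+1; rewrite hb (lowered_delta b (absz (b ord0)).+1%:Z)
  => /P_lower[b' b'0 /lowered_inj e].
have := b'0 ord0; rewrite -e !ffunE; have := b0 ord0; have := a_gt0 ord0.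
by move: (a ord0) (b ord0) => m z; nia.
Qed.

(** Move a maximal weight to the dominant chamber by w = w_0 t_g, then undo only the finite part
    w_0; the result is its image under t_g. *)
Lemma Ntilde_representative b : exists g c, in_lattice g /\ Ntilde (lowered b +
  k%:R *: g + c *: delta).
Proof.
have [c Pc] := coset_P b; have [n mx] := exists_maximal Pc.
have [s ds] := P_dominant_conj (proj1 mx).
have [s0 [g [Mg hs]]] := weyl_decomposition s.
set mu := (_ + _ *: delta) in mx ds.
have lmu : lev mu = k%:R by rewrite /mu levD levD lev_lowered !levZ lev_delta
  !mulr0 !addr0.
exists g, (c + n%:R - (form mu g + 2^-1 * form g g * k%:R)); split=> //.
exists (rev s0), (weyl_word s mu); split; first by split=> //; exact: maximal_weyl_word.
rewrite hs [RHS]fin_wordE fin_wordE map_rev weyl_word_revK translE lmu /mu.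
by apply: ev_inj => h; rewrite !evE; ring.
Qed.

(** * Translation classes and congruences *)

Definition coset_diff (b : {ffun 'I_l.+1 -> int}) (i : 'I_l) : int :=
  (a ord0)%:Z * b (@node X i) - (a (@node X i))%:Z * b ord0.

(** Comparing coefficients gives b_j - b'_j = k x_j + c a_j, and the combination a_0 b_i - a_i b_0
    eliminates the scalar c. *)
Lemma lowered_transl_diff b b' z c :
  lowered b' = lowered b + k%:R *: lattice_vec z + c *: delta ->
  forall i, coset_diff b i - coset_diff b' i = k%:Z * (d0 (@node X i))%:Z * z i.
Proof.
pose x j : K := oapp (fun i => (z i)%:~R * ((d0 j)%:R / (a ord0)%:R)) 0 (unlift ord0 j).
rewrite lattice_vec_comb -/x => e i.
have cE j : (b j)%:~R - (b' j)%:~R = k%:R * x j + c * (a j)%:R.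
  apply/eqP; rewrite -subr_eq0; apply/eqP.
  apply: (@root_free (fun j => (b j)%:~R - (b' j)%:~R - (k%:R * x j + c * (a j)%:R))).
  rewrite /root_comb; under eq_bigr => m _ do rewrite !scalerBl scalerDl -!scalerA.
  rewrite !sumrB big_split /= -!scaler_sumr -/(root_comb x) -/delta.
  move: e; rewrite /lowered -!addrA => /addrI e; rewrite e.
  by apply: ev_inj => h; rewrite !evE ev0; ring.
apply: (@intr_inj K); rewrite /coset_diff !(rmorphB, rmorphM) /= -!pmulrn.
have e0 := cE ord0; have ei := cE (node i).
rewrite /x unlift_none liftK /= mulr0 add0r in e0 ei.
have a00 := a_neq0 ord0.
transitivity ((a ord0)%:R * ((b (node i))%:~R - (b' (node i))%:~R) -
  (a (node i))%:R * ((b ord0)%:~R - (b' ord0)%:~R) : K); first by ring.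
by rewrite e0 ei; field.
Qed.

Lemma diff_lowered_transl b b' z :
  (forall i, coset_diff b i - coset_diff b' i = k%:Z * (d0 (@node X i))%:Z * z i) ->
  exists c, lowered b' = lowered b + k%:R *: lattice_vec z + c *: delta.
Proof.
move=> dz; have a00 := a_neq0 ord0.
(* The coefficient of alpha_0 dictates this value, as vectors of M have none. *)
exists (((b ord0)%:~R - (b' ord0)%:~R) / (a ord0)%:R).
rewrite lattice_vec_comb.
set x := (fun j => _); set c := _ / _.
have cE j : (b' j)%:~R = (b j)%:~R - (k%:R * x j + c * (a j)%:R) :> K.
  have [->|j0] := eqVneq j ord0.
    by rewrite /x unlift_none mulr0 add0r /c; field.
  have [i ->] := node_surj j0; rewrite /x liftK /=.
  have := congr1 (fun z : int => z%:~R : K) (dz i).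
  rewrite /coset_diff !(rmorphB, rmorphM) /= -!pmulrn => h.
  apply: (mulfI a00); rewrite mulrBr mulrDr.
  have -> : (a ord0)%:R * (k%:R * ((z i)%:~R * ((d0 (node i))%:R / (a ord0)%:R))) =
    k%:R * (d0 (node i))%:R * (z i)%:~R :> K by field.
  by rewrite -h /c; field.
have e : \sum_i (b' i)%:~R *: root i =
    \sum_i (b i)%:~R *: root i - (k%:R *: root_comb x + c *: delta).
  rewrite /root_comb /delta !scaler_sumr -big_split -sumrB; apply: eq_bigr => j _ /=.
  by rewrite cE scalerBl scalerDl !scalerA.
by rewrite /lowered e; apply: ev_inj => h; rewrite !evE; ring.
Qed.

Lemma exists_mark1 : exists i, a i = 1%N.
Proof.
case: (boolP (is_A_2_even X)) => t.
  exists ord_max; rewrite a_mark /=; move: t; case: (X) => //= n _; by rewrite eqxx.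
by exists ord0; rewrite a_mark /= mark0 // (negPf t).
Qed.

Lemma transl_coset b b' :
  (exists g, exists s : int, in_lattice g /\ lowered b
    = t_ g (lowered b') - s%:~R *: delta) <->
  (forall i, exists z : int, coset_diff b i - coset_diff b' i =
     k%:Z * (d0 (@node X i))%:Z * z).
Proof.
split=> [[g [s [[z ->] e]]] i|cong].
  exists (- z i); rewrite mulrN -(@lowered_transl_diff b' b z (- (form (lowered
    b') (lattice_vec z) + 2^-1 * form (lattice_vec z) (lattice_vec z) * k%:R) -
      s%:~R)) ?opprB //.
  by rewrite e translE lev_lowered; apply: ev_inj => h; rewrite !evE; ring.
have [z hz] := choice cong.
have [c e] : exists c, lowered b = lowered b' + k%:R *: lattice_vec (fun i =>
  - z i) + c *: delta.
  by apply: diff_lowered_transl => i; rewrite mulrN -hz [RHS]opprB.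
set g := lattice_vec _ in e; have Mg : in_lattice g by eexists.
pose s := - c - (form (lowered b') g + 2^-1 * form g g * k%:R).
have es : lowered b = t_ g (lowered b') - s *: delta.
  by rewrite e translE lev_lowered /s; apply: ev_inj => h; rewrite !evE; ring.
(* So far s is only a scalar. Since t_g lies in W, it preserves Lam - Q, so s delta lies in Q; the
   coefficient at a node of mark 1 shows that s is an integer. *)
have [w hw] := in_lattice_weyl_transl Mg; have [b2 hb2] := lowered_weyl_word w b'.
have [i ai] := exists_mark1.
have sE : s = (b i - b2 i)%:~R.
  apply/eqP; rewrite -subr_eq0; apply/eqP.
  have -> : s - (b i - b2 i)%:~R = s * (a i)%:R - ((b i)%:~R - (b2 i)%:~R).
    by rewrite ai mulr1 rmorphB.
  apply: (@root_free (fun j => s * (a j)%:R - ((b j)%:~R - (b2 j)%:~R))).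
  rewrite /root_comb; under eq_bigr => m _ do rewrite !scalerBl -!scalerA.
  rewrite !sumrB -scaler_sumr -/delta.
  move: es; rewrite hw hb2 /lowered -addrA => /addrI es.
  by rewrite -[\sum_i _ *: _ - _]opprB opprK; apply: ev_inj => h;
     have := congr1 (fun x => ev x h) es; rewrite !evE ev0 => e'; ring: e'.
by exists g, (b i - b2 i); rewrite -sE.
Qed.

Definition congruent b b' := forall i, exists z : int,
  coset_diff b i - coset_diff b' i = k%:Z * (d0 (@node X i))%:Z * z.

Lemma Ntilde_lowered eta : Ntilde eta -> exists b, eta = lowered b.
Proof. by move=> /Ntilde_maximal[/P_lower[b _ ->] _]; exists b. Qed.

(** Elements of W preserve maximality, so the multiple of delta left over by the translation must be
    zero. *)
Lemma congruent_Ntilde b b' : Ntilde (lowered b) -> Ntilde (lowered b') ->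
  congruent b b' ->
  exists2 g, in_lattice g & lowered b = t_ g (lowered b').
Proof.
move=> Nb Nb' /transl_coset[g [s [Mg e]]]; exists g => //.
have [w hw] := in_lattice_weyl_transl Mg.
have mx : maximal (t_ g (lowered b')) by rewrite hw;
  apply/maximal_weyl_word/Ntilde_maximal.
have : maximal (lowered b + s%:~R *: delta) by rewrite e subrK.
move=> /(maximal_unique (Ntilde_maximal Nb)) s0.
by rewrite e s0 scale0r subr0.
Qed.

Lemma Ntilde_congruent b : exists b', Ntilde (lowered b') /\ congruent b' b.
Proof.
have [_ [c [[z ->] Nt]]] := Ntilde_representative b.
have [b' hb'] := Ntilde_lowered Nt; rewrite hb' in Nt.
exists b'; split=> // i; exists (- z i).
by rewrite mulrN -(lowered_transl_diff (esym hb')) [RHS]opprB.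
Qed.

End WeightSet.

End WeylGroup.

(** * Residues and the main theorem *)

Lemma card_eq_finpred (T : finType) (A : {pred T}) : [set x | x \in A] #= `I_#|A|.
Proof.
have -> : [set x | x \in A] = (@enum_val T A) @` [set: 'I_#|A|].
  apply/seteqP; split=> [x Ax|_ [i _ <-]]; last exact: enum_valP.
  by exists (enum_rank_in Ax x) => //; rewrite enum_rankK_in.
apply: card_eq_trans (inj_card_eq _) (card_esym card_II).
by apply: in2W; apply: enum_val_inj.
Qed.

Lemma foldr_muln_map (I : finType) (F : I -> nat) :
  foldr muln 1%N [seq F x | x : I] = (\prod_x F x)%N.
Proof.
rewrite -[RHS]big_enum /image_mem /=; elim: (enum I) => [|x s IH] /=.
  by rewrite big_nil.
by rewrite big_cons IH.
Qed.

Lemma val_residue n z : (0 < n)%N -> (val (residue n z))%:Z = (z %% n)%Z.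
Proof.
move=> n0; rewrite /residue /inZp /= prednK //.
have zn : (z %% n)%Z = (absz (z %% n)%Z)%:Z.
  by rewrite abszE ger0_norm // modz_ge0 // eqz_nat -lt0n.
by rewrite [RHS]zn modn_small // -ltz_nat -zn ltz_pmod.
Qed.

Lemma residue_eqP n z z' : (0 < n)%N ->
  residue n z = residue n z' <-> exists q : int, z - z' = n%:Z * q.
Proof.
move=> n0; split=> [/(congr1 (fun x : Zmod n => (val x)%:Z))|[q e]].
  rewrite !val_residue // => /eqP; rewrite eqz_mod_dvd => /dvdzP[q ->].
  by exists q; rewrite mulrC.
apply/val_inj; apply/eqP; rewrite -eqz_nat !val_residue // eqz_mod_dvd e.
exact: dvdz_mulr.
Qed.

Lemma residue_val n (x : Zmod n) : (0 < n)%N -> residue n (val x)%:Z = x.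
Proof.
move=> n0; apply/val_inj; apply/eqP; rewrite -eqz_nat val_residue // modz_nat eqz_nat.
by rewrite modn_small // -[X in (_ < X)%N](prednK n0) ltn_ord.
Qed.

(** The modulus is even, so parity does not depend on the representative. *)
Lemma even_classE m n (x : Zmod n) : (0 < m)%N -> n = (m * 2)%N ->
  even_class x <-> ~~ odd (val x).
Proof.
move=> m0 nE; subst n; have n0 : (0 < m * 2)%N by rewrite muln_gt0 m0.
split=> [[z _ <-]|ex].
  have := val_residue (2 * z) n0; move: (val _) => v vE.
  have := divz_eq (2 * z) (m * 2)%N; rewrite -vE; move: (divz _ _) => q e.
  have : exists t : int, v%:Z = 2 * t by exists (z - q * m); move: e;
    rewrite PoszM; lia.
  by case=> t; lia.
exists ((val x)./2)%:Z => //; rewrite -[RHS]residue_val //; congr residue.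
have := even_halfK ex; lia.
Qed.

Lemma card_even_class m n : (0 < m)%N -> n = (m * 2)%N ->
  #|[pred x : Zmod n | ~~ odd (val x)]| = m.
Proof.
move=> m0 nE; subst n; have n0 : (0 < m * 2)%N by rewrite muln_gt0 m0.
pose f (j : 'I_m) := residue (m * 2) (2 * j%:Z).
have fv j : val (f j) = (2 * j)%N.
  apply/eqP; rewrite -eqz_nat val_residue // -PoszM modz_nat eqz_nat modn_small //.
  by rewrite mulnC ltn_mul2r ltn_ord.
have finj : injective f.
  move=> i j /(congr1 val); rewrite !fv => /eqP; rewrite eqn_mul2l /= => /eqP.
  exact: val_inj.
rewrite -[RHS](card_ord m) -(card_codom finj); apply: eq_card => x; rewrite inE.
apply/idP/codomP => [ex|[j ->]]; last by rewrite fv mul2n odd_double.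
have xm : ((val x)./2 < m)%N.
  have : (val x < m * 2)%N by rewrite -[X in (_ < X)%N](prednK n0) ltn_ord.
  by have := even_halfK ex; lia.
exists (Ordinal xm); apply/val_inj; rewrite fv /=; have := even_halfK ex; lia.
Qed.

(** * Application to the irreducible highest weight module *)

Section MaximalWeights.
Variables (R : realType) (X : affine_type) (G : affineKM R X).
Hypothesis adm : admissible X.
Variables a av : 'I_(rk X).+1 -> nat.
Hypotheses (ha : is_marks (cartan X) a) (hav : is_marks (cartan X)^T av).
Variable form : weight G -> weight G -> R[i].
Hypothesis hform : invariant_form a av form.
Variables (k : nat) (Lam : weight G).
Hypotheses (k_gt0 : (0 < k)%N) (domL : dominant_integral Lam).
Hypothesis levL : level av Lam = k%:R.
Variable V : representation G.
Hypothesis hV : irreducible_integrable_highest_weight Lam V.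

Let ev (x : weight G) (h : km_h G) : R[i] := x h.

Let evD x y h : ev (x + y) h = ev x h + ev y h.
Proof. by rewrite /ev add_lfunE. Qed.

Let evZ c x h : ev (c *: x) h = c * ev x h.
Proof. by rewrite /ev scale_lfunE. Qed.

Let ev_inj x y : (forall h, ev x h = ev y h) -> x = y.
Proof. by move=> h; apply/lfunP. Qed.

Let pairing i j : ev (km_root G j) (km_coroot G i) = (cartan X i j)%:~R.
Proof. exact: km_pairing. Qed.

Let levE x : level av x = \sum_i (av i)%:R * ev x (km_coroot G i).
Proof.
by rewrite /level /central_element linear_sum; apply: eq_bigr => i _; rewrite linearZ.
Qed.

Let formDr x y z : form x (y + z) = form x y + form x z.
Proof. by case: hform => /(_ x 1 y z); rewrite !scale1r. Qed.

Let formZr x c y : form x (c *: y) = c * form x y.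
Proof.
have f0 : form x 0 = 0 by apply: (addrI (form x 0)); rewrite -formDr !addr0.
by case: hform => /(_ x c y 0) + _ _; rewrite f0 !addr0.
Qed.

Let formC x y : form x y = form y x.
Proof. by case: hform. Qed.

Let form_root i eta :
  form (km_root G i) eta = (av i)%:R / (a i)%:R * ev eta (km_coroot G i).
Proof. by case: hform => _ _ ->. Qed.

Let root_free x : root_comb (km_root G) x = 0 -> forall i, x i = 0.
Proof.
move=> e; have /freeP := (km_root_free G : free [tuple km_root G i | i < (rk X).+1]).
apply; rewrite -[RHS]e; apply: eq_bigr => i _; congr (_ *: _).
by rewrite (nth_map i) ?size_enum_ord ?ltn_ord // nth_ord_enum.
Qed.

Let P_lower mu : weights V mu ->
  exists2 b : {ffun 'I_(rk X).+1 -> int}, (forall i, 0 <= b i) & mu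
    = lowered (km_root G) Lam b.
Proof. by case: hV => irr _ [v [v0 wv ev0]]; exact: (weights_lower irr v0 wv ev0). Qed.

Let P_Lam : weights V Lam.
Proof. by case: hV => _ _ [v [v0 wv _]]; exists v. Qed.

Let P_sub i mu (m t : nat) : weights V mu -> ev mu (km_coroot G i) = m%:R ->
  (t <= m)%N -> weights V (mu - t%:R *: km_root G i).
Proof. by case: hV => _ int _; exact: weights_sub_root. Qed.

Let P_add i mu (m t : nat) : weights V mu -> ev mu (km_coroot G i) = - m%:R ->
  (t <= m)%N -> weights V (mu + t%:R *: km_root G i).
Proof. by case: hV => _ int _; exact: weights_add_root. Qed.

Let aE i : a i = mark X i.
Proof. exact: (a_mark adm pairing ha hav formC form_root). Qed.

Let dE i : d a av i = dX X (node i).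
Proof.
by rewrite /d /dX !aE (av_comark adm pairing ha hav formC form_root).
Qed.

Let kd_gt0 i : (0 < k * d a av i)%N.
Proof.
rewrite muln_gt0 k_gt0 dE.
by have /andP[] := dX_dvd adm (ltn_ord (node i) : (node i <= rk X)%N).
Qed.

Let latticeM_in_lattice al : latticeM a av al <-> in_lattice (km_root G) a al.
Proof.
have e (z : 'I_(rk X) -> int) :
    \sum_i (z i)%:~R *: (((d a av i)%:R / (a ord0)%:R) *: km_root G (node i)) =
    lattice_vec (km_root G) a z.
  by apply: eq_bigr => i _; rewrite beta_node dE.
by split=> -[z ->]; exists z; rewrite e.
Qed.

Let lE b : lowered (km_root G) Lam b = lower Lam b.
Proof. by []. Qed.

Let tE al eta : translation (km_root G) a (level av) form al eta
  = transl a av form al eta.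
Proof. by []. Qed.

Lemma translate_lower_iff b b' :
  (exists al s, latticeM a av al /\
     lower Lam b = transl a av form al (lower Lam b') - s%:~R *: null_root G a) <->
  congruent a k b b'.
Proof.
have coset := transl_coset adm evD evZ ev_inj pairing ha hav levE formDr formZr formC
  form_root root_free levL domL b b'.
rewrite !lE in coset.
split=> [[al [s [Ml e]]]|cong].
  apply/coset; exists al, s; split; first exact/latticeM_in_lattice.
  by rewrite tE e.
have /coset[al [s [Ml e]]] := cong.
exists al, s; split; first exact/latticeM_in_lattice.
by rewrite e tE.
Qed.

Lemma root_coord_lower b : root_coord Lam (lower Lam b : weight G) = b.
Proof.
have /= e := @xgetPex _ [ffun=> 0] [set b' | lower Lam b = lower Lam b' :> weight G]
  (ex_intro _ b erefl).
by apply: (lowered_inj root_free (Lam := Lam)); rewrite !lE; exact/esym.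
Qed.

Lemma tilde_lower b i : tilde a av k Lam (lower Lam b : weight G) i =
  residue (k * d a av i) (coset_diff a b i).
Proof. by rewrite /tilde ffunE root_coord_lower. Qed.

Lemma tilde_lower_eq b b' :
  tilde a av k Lam (lower Lam b : weight G) = tilde a av k Lam (lower Lam b' :
    weight G) <->
  congruent a k b b'.
Proof.
split=> [/ffunP e i|cong].
  have := e i; rewrite !tilde_lower => /(residue_eqP _ _ (kd_gt0 i))[z ->].
  by exists z; rewrite dE PoszM.
apply/ffunP => i; rewrite !tilde_lower; apply/(residue_eqP _ _ (kd_gt0 i)).
by have [z ->] := cong i; exists z; rewrite dE PoszM.
Qed.

Lemma translate_iff_tilde eta zeta : root_coset Lam eta -> root_coset Lam zeta ->
  (exists al s, latticeM a av al /\
     eta = transl a av form al zeta - s%:~R *: null_root G a) <->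
  tilde a av k Lam eta = tilde a av k Lam zeta.
Proof.
by move=> [b _ <-] [b' _ <-]; rewrite tilde_lower_eq; exact: translate_lower_iff.
Qed.

Let Nt := Ntilde ev (km_root G) (km_coroot G) a (weights V).

Let orbit_Ntilde eta : finite_weyl_orbit (max_dominant a V) eta <-> Nt eta.
Proof.
split=> [[w [mu [mx dm] ->]]|[w [mu [[mx dm] ->]]]].
  by exists w, mu.
by exists w, mu.
Qed.

Let Ntilde_lower eta : Nt eta -> exists b, eta = lower Lam b.
Proof.
by move=> /(Ntilde_lowered evD evZ ev_inj pairing ha domL P_lower P_sub P_add)[b
  ->]; exists b.
Qed.

(** * The residue map on a transversal *)

Section Transversal.
Variable Nbar : set (weight G).
Hypothesis hNbar :
  is_T_transversal a av form (finite_weyl_orbit (max_dominant a V)) Nbar.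

Let Nbar_Ntilde eta : Nbar eta -> Nt eta.
Proof. by case: hNbar => sub _ /sub /orbit_Ntilde. Qed.

Let same_class_tilde eta zeta : Nt eta -> Nt zeta -> same_T_class a av form eta zeta ->
  tilde a av k Lam zeta = tilde a av k Lam eta.
Proof.
move=> /Ntilde_lower[b ->] /Ntilde_lower[b' ->] [al Ml e].
by apply/tilde_lower_eq/translate_lower_iff; exists al, 0; rewrite scale0r subr0.
Qed.

(** Equal residues put eta and zeta in one T-class, in which the transversal has a single
    element. *)
Lemma tilde_inj : set_inj Nbar (tilde a av k Lam).
Proof.
move=> eta zeta /set_mem Neta /set_mem Nzeta.
have Ne := Nbar_Ntilde Neta; have Nz := Nbar_Ntilde Nzeta.
have [b hb] := Ntilde_lower Ne; have [b' hb'] := Ntilde_lower Nz.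
rewrite hb hb' => /tilde_lower_eq cong; rewrite -hb -hb'.
have [g Mg e] : exists2 g, in_lattice (km_root G) a g &
    lowered (km_root G) Lam b = translation (km_root G) a (level av) form g
      (lowered (km_root G) Lam b').
  rewrite hb in Ne; rewrite hb' in Nz.
  exact: (congruent_Ntilde adm evD evZ ev_inj pairing ha hav levE formDr formZr formC
    form_root root_free k_gt0 levL domL P_lower P_sub P_add Ne Nz cong).
rewrite !lE tE -hb -hb' in e.
case: hNbar => sub /(_ zeta (sub _ Nzeta))[xi [_ uniq]].
have sz : same_T_class a av form zeta zeta.
  exists 0; first by apply/latticeM_in_lattice; exact: in_lattice_0.
  by rewrite -tE transl0.
have se : same_T_class a av form zeta eta by exists g => //; apply/latticeM_in_lattice.
by rewrite -(uniq eta (conj Neta se)) (uniq zeta (conj Nzeta sz)).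
Qed.

(** Every b is congruent to an element of the finite Weyl orbits, and the representative of its
    T-class has the same residues. *)
Lemma tilde_image :
  tilde a av k Lam @` Nbar = [set x | exists b, x
    = tilde a av k Lam (lower Lam b : weight G)].
Proof.
apply/seteqP; split=> [_ [eta /Nbar_Ntilde/Ntilde_lower[b ->] <-]|x [b ->]] /=;
  first by exists b.
have [b' [Nb' cong]] := Ntilde_congruent adm evD evZ ev_inj pairing ha hav levE formDr
  formZr formC form_root root_free k_gt0 levL domL P_lower P_Lam P_sub P_add b.
have [_ /(_ _ (proj2 (orbit_Ntilde _) Nb'))[zeta [[Nz sz] _]]] := hNbar.
exists zeta => //; rewrite (same_class_tilde Nb' (Nbar_Ntilde Nz) sz).
exact/tilde_lower_eq.
Qed.

Let coset_of (b0 : int) (y : 'I_(rk X) -> int) : {ffun 'I_(rk X).+1 -> int} :=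
  [ffun j => oapp y b0 (unlift ord0 j)].

Let coset_of_diff b0 y i :
  coset_diff a (coset_of b0 y) i = (a ord0)%:Z * y i - (a (node i))%:Z * b0.
Proof. by rewrite /coset_diff !ffunE liftK unlift_none. Qed.

Lemma tilde_image_full : ~~ is_A_2_even X -> tilde a av k Lam @` Nbar = setT.
Proof.
move=> tX; rewrite tilde_image; apply/seteqP; split=> // x _.
(* Here a_0 = 1, so b_0 = 0 and b_i = x_i realize the given residues. *)
exists (coset_of 0 (fun i => (val (x i))%:Z)); apply/ffunP => i.
rewrite tilde_lower coset_of_diff aE mark0 // (negPf tX) mul1r mulr0 subr0.
by rewrite residue_val.
Qed.

(** The ordinal i stands for the node i + 1, so [i.+1 < rk X] excludes exactly the node l. *)
Lemma tilde_image_even : is_A_2_even X -> tilde a av k Lam @` Nbar =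
  [set x : residues a av k | forall i : 'I_(rk X), (i.+1 < rk X)%N -> even_class (x i)].
Proof.
move=> tX; have a0 : a ord0 = 2%N by rewrite aE mark0 // tX.
have ai (i : 'I_(rk X)) : (i.+1 < rk X)%N -> a (node i) = 2%N.
  by move=> il; rewrite aE mark_A_2_even //= /bump add1n ltn_eqF.
have al (i : 'I_(rk X)) : (i.+1 < rk X)%N = false -> a (node i) = 1%N.
  by move=> il; rewrite aE mark_A_2_even //= /bump add1n eqn_leq ltn_ord leqNgt il.
rewrite tilde_image; apply/seteqP; split=> [_ [b ->] i il|x xe].
  rewrite tilde_lower; exists (b (node i) - b ord0) => //.
  by rewrite /coset_diff a0 ai // mulrBr.
have [l0|l0] := posnP (rk X).
  by exists 0; apply/ffunP => i; have := ltn_ord i; rewrite [X in (_ < X)%N]l0.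
have lp : ((rk X).-1 < rk X)%N by rewrite prednK.
have /choice[y hy] : forall i : 'I_(rk X), exists y : int,
    (i.+1 < rk X)%N -> residue (k * d a av i) (2 * y) = x i.
  move=> i; have [il|] := boolP (i.+1 < rk X)%N; last by exists 0.
  by have [y _ hy] := xe i il; exists y.
(* At the node l, where a_l = 1, the component is 2 b_l - b_0, so b_l = 0 and b_0 = - x_l realize
   x_l. At the other nodes b_i = y_i + b_0 then yields 2 y_i. *)
pose b0 : int := - (val (x (Ordinal lp)))%:Z.
exists (coset_of b0 (fun i => if (i.+1 < rk X)%N then y i + b0 else 0));
  apply/ffunP => i.
rewrite tilde_lower coset_of_diff a0; case: ifP => il.
  by rewrite ai // mulrDr addrK hy.
have e : i = Ordinal lp.
  by apply/val_inj => /=; apply/eqP; rewrite -eqSS prednK // eqn_leq ltn_ord leqNgt il.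
by rewrite al // mulr0 sub0r mul1r /b0 opprK e residue_val.
Qed.

Lemma card_Nbar (A : {pred residues a av k}) :
  tilde a av k Lam @` Nbar = [set x | x \in A] -> Nbar #= `I_#|A|.
Proof.
move=> e; apply: card_eq_trans (card_eq_finpred A).
rewrite -e card_eq_sym; exact: inj_card_eq tilde_inj.
Qed.

Lemma card_Nbar_full : ~~ is_A_2_even X ->
  Nbar #= `I_(k ^ rk X * \prod_(i < rk X) d a av i).
Proof.
move=> /tilde_image_full e.
have := @card_Nbar predT; rewrite card_dep_ffun foldr_muln_map.
have -> : (\prod_i #|Zmod (k * d a av i)| = k ^ rk X * \prod_(i < rk X) d a av i)%N.
  rewrite -[X in (k ^ X)%N](card_ord (rk X)) -prod_nat_const -big_split.
  by apply: eq_bigr => i _; rewrite card_ord prednK.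
by apply; rewrite e; apply/seteqP; split.
Qed.

Lemma card_Nbar_even : is_A_2_even X -> Nbar #= `I_(k ^ rk X).
Proof.
move=> tX; have e := tilde_image_even tX.
have dlast (i : 'I_(rk X)) : d a av i = if (i.+1 < rk X)%N then 2%N else 1%N.
  rewrite dE (dX_A_2_even adm) //= /bump add1n eqn_leq ltn_ord leqNgt.
  by case: ltnP.
have even2 (i : 'I_(rk X)) : (i.+1 < rk X)%N -> (k * d a av i = k * 2)%N.
  by move=> il; rewrite dlast il.
(* The image is a product: the k even classes modulo 2k at each node before l, and all k classes
   modulo k at l. *)
pose F (i : 'I_(rk X)) : {pred Zmod (k * d a av i)} :=
  fun y => (i.+1 < rk X)%N ==> ~~ odd (val y).
have Fcard i : #|F i| = k.
  have [il|il] := boolP (i.+1 < rk X)%N.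
    rewrite -[RHS](card_even_class k_gt0 (even2 i il)); apply: eq_card => y.
    by rewrite !inE /F unfold_in il.
  rewrite (eq_card (B := predT)) => [|y]; last by rewrite !inE unfold_in (negPf il).
  by rewrite card_ord prednK // dlast (negPf il) muln1.
have := @card_Nbar (family F); rewrite card_family foldr_muln_map.
have -> : (\prod_i #|F i| = k ^ rk X)%N.
  by under eq_bigr => i _ do rewrite Fcard; rewrite prod_nat_const card_ord.
apply; rewrite e; apply/seteqP; split=> x /= hx.
  apply/familyP => i; rewrite unfold_in; apply/implyP => il.
  by apply/(even_classE _ k_gt0 (even2 i il)); exact: hx.
move=> i il; apply/(even_classE _ k_gt0 (even2 i il)).
by have /familyP/(_ i) := hx; rewrite unfold_in il.
Qed.

End Transversal.

End MaximalWeights.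

Theorem proposition2p6 (R : realType) (X : affine_type) (hX : admissible X)
  (G : affineKM R X) (a av : 'I_(rk X).+1 -> nat)
  (ha : is_marks (cartan X) a) (hav : is_marks (cartan X)^T av)
  (form : weight G -> weight G -> R[i]) (hform : invariant_form a av form)
  (k : nat) (hk : (0 < k)%N) (Lam : weight G)
  (hLam : dominant_integral Lam) (hlevel : level av Lam = k%:R)
  (V : representation G)
  (hV : irreducible_integrable_highest_weight Lam V)
  (Nbar : set (weight G))
  (hNbar : is_T_transversal a av form
             (finite_weyl_orbit (max_dominant a V)) Nbar) :
  [/\ (* (1) *)
      forall eta zeta : weight G, root_coset Lam eta -> root_coset Lam zeta ->
        (exists al : weight G, exists s : int, latticeM a av al /\
           eta = transl a av form al zeta - s%:~R *: null_root G a) <->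
        tilde a av k Lam eta = tilde a av k Lam zeta,
      (* (2) *)
      set_inj Nbar (tilde a av k Lam),
      (* (3) *)
      ~~ is_A_2_even X ->
        tilde a av k Lam @` Nbar = setT /\
        Nbar #= `I_(k ^ rk X * \prod_(i < rk X) d a av i)
    & (* (4) *)
      is_A_2_even X ->
        tilde a av k Lam @` Nbar =
          [set x : residues a av k | forall i : 'I_(rk X), (i.+1 < rk X)%N ->
                     even_class (x i)] /\
        Nbar #= `I_(k ^ rk X)].
Proof.
split.
- by move=> eta zeta; exact: (translate_iff_tilde hX ha hav hform hk hLam hlevel).
- exact: (tilde_inj hX ha hav hform hk hLam hlevel hV hNbar).
- move=> tX; split.
    exact: (tilde_image_full hX ha hav hform hk hLam hlevel hV hNbar tX).
  exact: (card_Nbar_full hX ha hav hform hk hLam hlevel hV hNbar tX).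
- move=> tX; split.
    exact: (tilde_image_even hX ha hav hform hk hLam hlevel hV hNbar tX).
  exact: (card_Nbar_even hX ha hav hform hk hLam hlevel hV hNbar tX).
Qed.
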